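(* Let $\psi\in\mathfrak{fr}_k(x_0,x_1)$ be such that $c_{x_0}(\psi)=c_{x_1}(\psi)=c_{x_0x_1}(\psi)=0$. Then the following two conditions are equivalent: (i) $\psi\in\mathfrak{dmr}_0$; (ii) $l^{y,x}_{\mathbf a,\mathbf b}(\alpha(\psi))=0$ for all pairs of indices $(\mathbf a,\mathbf b)\neq((1,\dots,1),(1,\dots,1))$ (that is, all pairs of indices, of arbitrary depths, whose entries are not all equal to $1$).
   Context: Let $k$ be a field of characteristic zero, $A=k\langle\langle x_0,x_1\rangle\rangle$ the algebra of noncommutative formal power series, $c_w(\varphi)$ the coefficient of the word $w$ in $\varphi\in A$, and $\mathfrak{fr}_k(x_0,x_1)\subset A$ the (completed) free Lie algebra on $x_0,x_1$, whose elements are formal Lie series. Double shuffle Lie algebra. $\mathfrak{dmr}_0$ is the set of $\psi\in\mathfrak{fr}_k(x_0,x_1)$ with $c_{x_0}(\psi)=c_{x_1}(\psi)=c_{x_0x_1}(\psi)=0$ and $\Delta_*(\psi_* )=1\otimes\psi_*+\psi_*\otimes1$, where $\psi_*=\psi_{\mathrm{corr}}+\pi_Y(\psi)\in k\langle\langle y_1,y_2,\dots\rangle\rangle$, $\psi_{\mathrm{corr}}=\sum_{n\ge1}\frac{(-1)^n}{n}c_{x_0^{n-1}x_1}(\psi)\,y_1^n$, $\pi_Y$ is the $k$-linear map sending words ending in $x_0$ to $0$ and $x_0^{n_m-1}x_1\cdots x_0^{n_1-1}x_1$ to $(-1)^m y_{n_m}\cdots y_{n_1}$, and $\Delta_*$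 is the coproduct (algebra morphism) with $\Delta_*y_n=\sum_{i=0}^n y_i\otimes y_{n-i}$, $y_0=1$. Pentagon defect. $\mathfrak p_5$ is the (degree-completed) Lie algebra over $k$ with generators $x_{ij}=x_{ji}$ ($1\le i,j\le5$) and relations $x_{ii}=0$, $\sum_{j=1}^5x_{ij}=0$ for all $i$, and $[x_{ij},x_{kl}]=0$ if $\{i,j\}\cap\{k,l\}=\emptyset$. Write $\psi_{ijk}:=\psi(x_{ij},x_{jk})\in\mathfrak p_5$. The defect is $\alpha(\psi):=\psi_{451}+\psi_{123}-\psi_{432}-\psi_{215}-\psi_{543}$. Polylogarithmic functionals. An index is a tuple $\mathbf a=(a_1,\dots,a_k)$, $k\ge1$, of positive integers; its depth is $k$. The degree-one part of $\mathfrak p_5$ has basis $x_{45},x_{34},x_{24},x_{12},x_{23}$; let $\omega_{45},\omega_{34},\omega_{24},\omega_{12},\omega_{23}$ be the dual basis (corresponding to $\frac{dy}{y},\frac{dy}{y-1},\frac{d(xy)}{xy-1},\frac{dx}{x},\frac{dx}{x-1}$). The word $[\omega_{i_m}|\cdots|\omega_{i_1}]$ (multilinear in its entries) is the functional extracting the coefficient of $x_{i_m}\cdots x_{i_1}$ from a noncommutative series in these five generators; combinations of words satisfying Chen's integrability condition descend to functionals on the completed $U\mathfrak p_5$. The following combinations are integrable. For $\mathbf a=(a_1,\dots,a_k)$ put $l^{y}_{\mathbf a}=(-1)^k[\omega_{45}^{a_k-1}|\omega_{34}|\cdots|\omega_{45}^{a_1-1}|\omega_{34}]$ and $l^{xy}_{\mathbf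 a}=(-1)^k[(\omega_{12}+\omega_{45})^{a_k-1}|\omega_{24}|\cdots|(\omega_{12}+\omega_{45})^{a_1-1}|\omega_{24}]$ (powers denote repeated tensor entries). With the conventions $l^{x,y}_{\emptyset,\mathbf b}:=l^y_{\mathbf b}$ and $l^{x,y}_{\mathbf a,\emptyset}:=l^{xy}_{\mathbf a}$, define recursively, for $\mathbf a=(a_1,\dots,a_k)$, $\mathbf b=(b_1,\dots,b_l)$, $k,l\ge1$: $l^{x,y}_{\mathbf a,\mathbf b}=X+Y$, where $X=[\omega_{12}|l^{x,y}_{(a_1,\dots,a_{k-1},a_k-1),\mathbf b}]$ if $a_k\ne1$, and $X=-[\omega_{23}|l^{x,y}_{(a_1,\dots,a_{k-1}),\mathbf b}]-[\omega_{12}-\omega_{23}|l^{x,y}_{(a_1,\dots,a_{k-1},b_1),(b_2,\dots,b_l)}]$ if $a_k=1$; $Y=[\omega_{45}|l^{x,y}_{\mathbf a,(b_1,\dots,b_{l-1},b_l-1)}]$ if $b_l\ne1$, and $Y=-[\omega_{34}|l^{x,y}_{\mathbf a,(b_1,\dots,b_{l-1})}]$ if $b_l=1$. (This is the bar-construction element of the iterated integral $\mathrm{Li}_{\mathbf a,\mathbf b}(x,y)=\sum_{0<m_1<\dots<m_k<n_1<\dots<n_l}\frac{x^{m_k}y^{n_l}}{m_1^{a_1}\cdots m_k^{a_k}n_1^{b_1}\cdots n_l^{b_l}}$.) Finally $l^{y,x}_{\mathbf a,\mathbf b}$ (corresponding to $\mathrm{Li}_{\mathbf a,\mathbf b}(y,x)$)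 is obtained from $l^{x,y}_{\mathbf a,\mathbf b}$ by exchanging $\omega_{12}\leftrightarrow\omega_{45}$ and $\omega_{23}\leftrightarrow\omega_{34}$ and fixing $\omega_{24}$. *)

(* Defs.v *)
From HB Require Import structures.
From mathcomp Require Import all_boot all_order all_algebra ring_quotient generic_quotient.
From mathcomp Require Import boolp functions.
From mathcomp Require Import ring zify.

Set Implicit Arguments.
Unset Strict Implicit.
Unset Printing Implicit Defensive.

Import GRing.Theory.
Local Open Scope ring_scope.
Local Open Scope quotient_scope.

(** Noncommutative formal power series: [f w] is the coefficient of [w]. *)

Definition series (R : nzRingType) (I : Type) : Type := seq I -> R.

HB.instance Definition _ (R : nzRingType) (I : Type) :=
  GRing.Zmodule.copy (series R I) (seq I -> R).

Section SeriesRing.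
Variables (R : nzRingType) (I : Type).
Implicit Types (f g h : series R I) (w : seq I).

Definition smul f g : series R I :=
  fun w => \sum_(i < (size w).+1) f (take i w) * g (drop i w).

Definition sone : series R I := fun w => (nilp w)%:R.

Definition lquo (c : I) f : series R I := fun w => f (c :: w).

Lemma smul_nil f g : smul f g [::] = f [::] * g [::].
Proof. by rewrite /smul big_ord_recl big_ord0 addr0. Qed.

Lemma smul_cons f g c w :
  smul f g (c :: w) = f [::] * g (c :: w) + smul (lquo c f) g w.
Proof. by rewrite {1}/smul big_ord_recl. Qed.

Lemma smulDl : left_distributive smul +%R.
Proof.
move=> f g h; apply/funext => w; rewrite /smul -[RHS]big_split /=.
by apply: eq_bigr => i _; rewrite -mulrDl.
Qed.

Lemma smulDr : right_distributive smul +%R.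
Proof.
move=> f g h; apply/funext => w; rewrite /smul -[RHS]big_split /=.
by apply: eq_bigr => i _; rewrite -mulrDr.
Qed.

Lemma smulA : associative smul.
Proof.
move=> f g h; apply/funext => w; elim: w f g h => [|c w IH] f g h.
  by rewrite !smul_nil mulrA.
rewrite !smul_cons smul_nil IH mulrDr mulrA -addrA; congr (_ + _).
have -> : lquo c (smul f g) =
    (fun v => f [::] * lquo c g v) + smul (lquo c f) g.
  by apply/funext => v; rewrite /lquo smul_cons.
rewrite smulDl; congr (_ + _).
by rewrite /smul mulr_sumr; apply: eq_bigr => i _; rewrite mulrA.
Qed.

Lemma smul1r : left_id sone smul.
Proof.
move=> f; apply/funext => w; rewrite /smul big_ord_recl take0 drop0 mul1r.
rewrite big1 ?addr0 // => i _; case: w i => [[]//|c w] i.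
by rewrite /sone /= mul0r.
Qed.

Lemma smulr1 : right_id sone smul.
Proof.
move=> f; apply/funext => w; elim: w f => [|c w IH] f.
  by rewrite smul_nil mulr1.
by rewrite smul_cons IH mulr0 add0r.
Qed.

Lemma sone_neq0 : sone != 0.
Proof.
by apply/eqP => /(congr1 (fun f : series R I => f [::])) /eqP; rewrite oner_eq0.
Qed.

HB.instance Definition _ := GRing.Zmodule_isNzRing.Build (series R I)
  smulA smul1r smulr1 smulDl smulDr sone_neq0.

Definition sscale (a : R) f : series R I := fun w => a * f w.

Lemma sscaleA a b f : sscale a (sscale b f) = sscale (a * b) f.
Proof. by apply/funext => w; rewrite /sscale mulrA. Qed.

Lemma sscale1 : left_id 1 sscale.
Proof. by move=> f; apply/funext => w; rewrite /sscale mul1r. Qed.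

Lemma sscaleDr : right_distributive sscale +%R.
Proof. by move=> a f g; apply/funext => w; rewrite /sscale mulrDr. Qed.

Lemma sscaleDl f : {morph sscale^~ f : a b / a + b}.
Proof. by move=> a b; apply/funext => w; rewrite /sscale mulrDl. Qed.

HB.instance Definition _ := GRing.Zmodule_isLmodule.Build R (series R I)
  sscaleA sscale1 sscaleDr sscaleDl.

Definition homog (n : nat) f : series R I :=
  fun w => if size w == n then f w else 0.

End SeriesRing.

Definition letter (R : nzRingType) (I : eqType) (c : I) : series R I :=
  fun w => (w == [:: c])%:R.

Definition bracket (R : nzRingType) (f g : R) : R := f * g - g * f.

Inductive lie_poly (k : fieldType) (I : eqType) : series k I -> Prop :=
| lie_letter c : lie_poly (letter k c)
| lie_zero : lie_poly 0
| lie_add f g : lie_poly f -> lie_poly g -> lie_poly (f + g)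
| lie_scale a f : lie_poly f -> lie_poly (a *: f)
| lie_bracket f g : lie_poly f -> lie_poly g -> lie_poly (bracket f g).

Definition lie_series (k : fieldType) (I : eqType) (f : series k I) : Prop :=
  forall n, lie_poly (homog n f).

(** The double shuffle Lie algebra. The alphabet {x_0, x_1} is [bool]. The
    alphabet {y_1, y_2, ...} is [nat], the letter [m] standing for y_(m+1),
    which corresponds to the word x_0^m x_1. *)

Definition x0 : bool := false.
Definition x1 : bool := true.

Section DoubleShuffle.
Variable k : fieldType.
Implicit Types (psi : series k bool) (S : series k nat) (w : seq nat).

Definition xblock (m : nat) : seq bool := rcons (nseq m x0) x1.

(* The coefficients of y_(n_m) ... y_(n_1) in pi_Y(psi), and below of y_1^n in
   psi_corr. *)
Definition pi_Y psi : series k nat :=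
  fun w => (-1) ^+ size w * psi (flatten [seq xblock m | m <- w]).

Definition psi_corr psi : series k nat := fun w =>
  if (0 < size w)%N && (w == nseq (size w) 0%N)
  then (-1) ^+ size w / (size w)%:R * psi (xblock (size w).-1) else 0.

Definition psi_star psi : series k nat := psi_corr psi + pi_Y psi.

(* The completed tensor square of k<<Y>> is k<<Y>><<Y>>: the coefficient of
   u (x) v in [T] is [T u v], and the product is the componentwise one. *)
Definition tensor_square := series (series k nat) nat.

Definition tens (f g : series k nat) : tensor_square := fun u => f u *: g.

(* y_n, with y_0 = 1 *)
Definition ygen (n : nat) : series k nat :=
  if n is m.+1 then letter k m else 1.

Definition Delta_letter (m : nat) : tensor_square :=
  \sum_(i < m.+2) tens (ygen i) (ygen (m.+1 - i)).

Definition Delta_word w : tensor_square := \prod_(m <- w) Delta_letter m.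

Definition weight w : nat := sumn [seq m.+1 | m <- w].

(* The sum over all words w of S_w Delta_*(w): u (x) v occurs in Delta_*(w) only
   if the weight of w is N := weight u + weight v, so that w has at most N
   letters, all of them among y_1, ..., y_N. *)
Definition Delta_star S : tensor_square := fun u v =>
  let N := (weight u + weight v)%N in
  \sum_(n < N.+1) \sum_(t : n.-tuple 'I_N)
    let w := [seq nat_of_ord i | i <- t] in S w * Delta_word w u v.

Definition dmr0 psi : Prop :=
  [/\ lie_series psi,
      psi [:: x0] = 0, psi [:: x1] = 0, psi [:: x0; x1] = 0
    & Delta_star (psi_star psi) = tens 1 (psi_star psi) + tens (psi_star psi) 1].

End DoubleShuffle.

(** The completed enveloping algebra of p_5, given by the same generators and
    relations as p_5; elements of p_5 are considered in it. The points 1, ..., 5 are the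
    elements of 'I_5 seen as Z/5, so that the numerals 1, ..., 5 denote them
    (5 being 0), and the letter [(i, j)] is the generator x_ij. *)

Definition gen5 : eqType := ('I_5 * 'I_5)%type.

Section P5.
Variable k : fieldType.

Definition x5 (i j : 'I_5) : series k gen5 := letter k ((i, j) : gen5).

Inductive p5_relator : series k gen5 -> Prop :=
| p5_sym i j : p5_relator (x5 i j - x5 j i)
| p5_diag i : p5_relator (x5 i i)
| p5_sum i : p5_relator (\sum_(j < 5) x5 i j)
| p5_comm i j m l : [&& i != m, i != l, j != m & j != l] ->
    p5_relator (bracket (x5 i j) (x5 m l)).

Inductive p5_ideal : series k gen5 -> Prop :=
| p5_ideal_gen f r g : p5_relator r -> p5_ideal (f * r * g)
| p5_ideal_add f g : p5_ideal f -> p5_ideal g -> p5_ideal (f + g).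

(* The relators being homogeneous, a series is in the closure of the ideal iff
   all its homogeneous components are in the ideal. *)
Definition p5_closed_ideal : {pred series k gen5} :=
  fun f => `[< forall n, p5_ideal (homog n f) >].

Lemma p5_closed_ideal_zmod : zmod_closed p5_closed_ideal.
Proof.
have z : p5_ideal 0 by rewrite -[0](mulr0 (0 * x5 0 0)); exact/p5_ideal_gen/p5_diag.
split=> [|f g /asboolP Hf /asboolP Hg]; apply/asboolP => n.
  by rewrite (_ : homog n 0 = 0) //; apply/funext => w; rewrite /homog; case: ifP.
have -> : homog n (f - g) = homog n f - homog n g.
  by apply/funext => w; rewrite /homog !fctE; case: ifP; rewrite ?subr0.
apply: p5_ideal_add => //; elim: (Hg n) => [f' r g' Hr|f' g' _ H1 _ H2].
  by rewrite -!mulNr; apply: p5_ideal_gen.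
by rewrite opprD; apply: p5_ideal_add.
Qed.

HB.instance Definition _ :=
  GRing.isZmodClosed.Build (series k gen5) p5_closed_ideal p5_closed_ideal_zmod.

Definition Up5 := Quotient.quot p5_closed_ideal.

(* psi(s_0, s_1) for s_0, s_1 without constant term; words longer than [w]
   contribute nothing to the coefficient of [w]. *)
Definition subst (I : eqType) (s0 s1 : series k I) (psi : series k bool) :
    series k I := fun w =>
  \sum_(n < (size w).+1) \sum_(u : n.-tuple bool)
    psi u * (\prod_(b <- u) (if b then s1 else s0)) w.

Definition psi5 (psi : series k bool) (i j m : 'I_5) : Up5 :=
  \pi_Up5 (subst (x5 i j) (x5 j m) psi).

Definition pentagon_defect (psi : series k bool) : Up5 :=
  psi5 psi 4 5 1 + psi5 psi 1 2 3 - psi5 psi 4 3 2 - psi5 psi 2 1 5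
    - psi5 psi 5 4 3.

End P5.

(** Functionals on series in the x_ij. A linear form on the span of the x_ij is
    given by its values on the generators, and [bar w l] is [w | l]: the word
    [w_m | ... | w_1] maps a series to the sum over all words
    x_(c_m) ... x_(c_1) of the products of their coefficient with
    w_m(c_m) ... w_1(c_1). *)

Section Functionals.
Variable k : fieldType.

Definition form := gen5 -> k.
Definition functional := series k gen5 -> k.

Definition eps : functional := fun f => f [::].

Definition bar (w : form) (l : functional) : functional :=
  fun f => \sum_(c : gen5) w c * l (lquo c f).

(* e_ij - e_jl + e_lm - e_mi, where e_ij is the indicator of {x_ij, x_ji}: the
   logarithmic differential of the cross-ratio of four points. *)
Definition cross_ratio (i j l m : 'I_5) (c : gen5) : int :=
  let e i j : int := ((c == (i, j)) || (c == (j, i)))%:R in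
  e i j - e j l + e l m - e m i.

(* The dual basis of (x_45, x_34, x_24, x_12, x_23), see [omega_admissible] and
   [omega_dual]. *)
Definition omega45 : form := fun c => (cross_ratio 4 5 3 1 c)%:~R.
Definition omega34 : form := fun c => (cross_ratio 3 4 1 5 c)%:~R.
Definition omega24 : form := fun c => (cross_ratio 2 4 1 5 c)%:~R.
Definition omega12 : form := fun c => (cross_ratio 1 2 5 3 c)%:~R.
Definition omega23 : form := fun c => (cross_ratio 2 3 1 5 c)%:~R.

Definition basis5 : seq gen5 := [:: (4, 5); (3, 4); (2, 4); (1, 2); (2, 3)].
Definition omega5 : seq form := [:: omega45; omega34; omega24; omega12; omega23].

Lemma ord5_ind (P : 'I_5 -> Prop) :
  P 0 -> P 1 -> P 2 -> P 3 -> P 4 -> forall i, P i.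
Proof.
move=> P0 P1 P2 P3 P4 [[|[|[|[|[|i]]]]] Hi] //.
- by rewrite (_ : Ordinal Hi = 0) //; apply: val_inj.
- by rewrite (_ : Ordinal Hi = 1) //; apply: val_inj.
- by rewrite (_ : Ordinal Hi = 2) //; apply: val_inj.
- by rewrite (_ : Ordinal Hi = 3) //; apply: val_inj.
- by rewrite (_ : Ordinal Hi = 4) //; apply: val_inj.
Qed.

Lemma omega_dual (a b : 'I_5) :
  nth 0 omega5 a (nth (0, 0) basis5 b) = (a == b)%:R.
Proof.
have -> (t : bool) : t%:R = (t%:R : int)%:~R :> k by case: t.
by elim/ord5_ind: a; elim/ord5_ind: b; apply: (congr1 intr); vm_compute.
Qed.

(* Compatibility with the relations of p_5 in degree one. *)
Definition admissible (w : form) : Prop :=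
  [/\ forall i j, w (i, j) = w (j, i), forall i, w (i, i) = 0
    & forall i, \sum_(j < 5) w (i, j) = 0].

Lemma omega_admissible (a : 'I_5) : admissible (nth 0 omega5 a).
Proof.
split=> [i j|i|i].
- by elim/ord5_ind: a; elim/ord5_ind: i; elim/ord5_ind: j;
     apply: (congr1 intr); vm_compute.
- by elim/ord5_ind: a; elim/ord5_ind: i;
     apply: (congr1 intr (y := 0)); vm_compute.
- by elim/ord5_ind: a; rewrite /= -(raddf_sum (intmul (1 : k)));
     elim/ord5_ind: i; apply: (congr1 intr (y := 0));
     rewrite !big_ord_recr big_ord0; vm_compute.
Qed.

(* (-1)^k [p^(a_k - 1) | q | ... | p^(a_1 - 1) | q] *)
Definition polylog1 (p q : form) (a : seq nat) : functional := fun f =>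
  (-1) ^+ size a * foldl (fun l n => iter n.-1 (bar p) (bar q l)) eps a f.

Definition init (a : seq nat) : seq nat := take (size a).-1 a.
Definition decr_last (a : seq nat) : seq nat := rcons (init a) (last 0%N a).-1.

Section Polylog2.
Variables w12 w45 w23 w34 w24 : form.

Definition polylogX (l : seq nat -> seq nat -> functional) (a b : seq nat) :=
  if last 0%N a != 1%N then bar w12 (l (decr_last a) b)
  else - bar w23 (l (init a) b)
       - bar (w12 - w23) (l (rcons (init a) (head 0%N b)) (behead b)).

Definition polylogY (l : seq nat -> seq nat -> functional) (a b : seq nat) :=
  if last 0%N b != 1%N then bar w45 (l a (decr_last b))
  else - bar w34 (l a (init b)).

Fixpoint polylog2_rec (n : nat) (a b : seq nat) : functional :=
  if nilp a then polylog1 w45 w34 b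
  else if nilp b then polylog1 (w12 + w45) w24 a
  else if n is n'.+1 then
    polylogX (polylog2_rec n') a b + polylogY (polylog2_rec n') a b
  else 0.

(* The recursion decreases the total weight by exactly one, see [polylog2E]. *)
Definition polylog2 (a b : seq nat) : functional :=
  polylog2_rec (sumn a + sumn b) a b.

Definition positive (a : seq nat) : bool := all (leq 1) a.

End Polylog2.
End Functionals.

(** The elements [polylog2] satisfy Chen's integrability condition, i.e. they
    vanish on the ideal defining the completed enveloping algebra of p_5. *)

Section Descent.
Variable k : fieldType.
Local Notation functional := (functional k).
Local Notation form := (form k).
Local Notation x5 := (x5 k).
Implicit Types (w p q : form) (l m : functional) (f g U V r : series k gen5).

Definition wedge w w' (c d : gen5) : k := w c * w' d - w d * w' c.

Definition disjoint5 (c d : gen5) : bool :=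
  [&& c.1 != d.1, c.1 != d.2, c.2 != d.1 & c.2 != d.2].

Definition wedge0 w w' : Prop := forall c d, disjoint5 c d -> wedge w w' c d = 0.

Definition linear_fun l : Prop := forall a f g, l (a *: f + g) = a * l f + l g.

(* Enough to kill the ideal when [l] is a sum of [bar w m]'s with [m] killing it *)
Record preint l : Prop := Preint {
  _ : linear_fun l;
  _ : forall U r V, p5_relator r -> l (U * r * V) = U [::] * l (r * V);
  _ : forall i j V, l (x5 i j * V) = l (x5 j i * V);
  _ : forall i V, l (x5 i i * V) = 0;
  _ : forall i V, l ((\sum_(j < 5) x5 i j) * V) = 0 }.

Definition commint l : Prop := forall c d V, disjoint5 c d ->
  l (bracket (x5 c.1 c.2) (x5 d.1 d.2) * V) = 0.

Definition integrable l := preint l /\ commint l.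

Lemma fnlD l m f : (l + m) f = l f + m f. Proof. by []. Qed.

Lemma fnlN l f : (- l) f = - l f. Proof. by []. Qed.

Lemma lin0 l : linear_fun l -> l 0 = 0.
Proof.
by move=> H; have := H (-1) 0 0; rewrite scaler0 addr0 mulN1r addNr.
Qed.

Lemma linD l f g : linear_fun l -> l (f + g) = l f + l g.
Proof. by move=> H; rewrite -[f]scale1r H mul1r scale1r. Qed.

Lemma linN l f : linear_fun l -> l (- f) = - l f.
Proof.
by move=> H; rewrite -[- f]addr0 -scaleN1r H lin0 // addr0 mulN1r.
Qed.

Lemma linB l f g : linear_fun l -> l (f - g) = l f - l g.
Proof. by move=> H; rewrite linD // linN. Qed.

Lemma lquoM (c : gen5) U V : lquo c (U * V) = U [::] *: lquo c V + lquo c U * V.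
Proof. by apply/funext => w; rewrite /lquo; exact: smul_cons. Qed.

Lemma mul_nil U V : (U * V) [::] = U [::] * V [::].
Proof. exact: smul_nil. Qed.

Lemma letter_nil (c : gen5) : letter k c [::] = 0. Proof. by []. Qed.

Lemma lquo_letter (c d : gen5) : lquo c (letter k d : series k gen5) = (c == d)%:R.
Proof.
apply/funext => w; rewrite /lquo /letter eqseq_cons.
by case: (c == d) => //=; case: w.
Qed.

Lemma add_lin l m : linear_fun l -> linear_fun m -> linear_fun (l + m).
Proof. by move=> Hl Hm a f g; rewrite !fnlD Hl Hm mulrDr addrACA. Qed.

Lemma opp_lin l : linear_fun l -> linear_fun (- l).
Proof. by move=> Hl a f g; rewrite !fnlN Hl opprD mulrN. Qed.

Lemma bar_lin w m : linear_fun m -> linear_fun (bar w m).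
Proof.
move=> H a f g; rewrite /bar mulr_sumr -big_split /=; apply: eq_bigr => c _.
have -> : lquo c (a *: f + g) = a *: lquo c f + lquo c g by [].
by rewrite H mulrDr mulrCA.
Qed.

Lemma bar_letter w m (c : gen5) V : linear_fun m -> bar w m (letter k c * V) = w c * m V.
Proof.
move=> H; rewrite /bar (bigD1 c) //= big1 => [|d /negPf dc];
  rewrite lquoM letter_nil scale0r add0r lquo_letter.
  by rewrite eqxx mul1r addr0.
by rewrite dc mul0r lin0 // mulr0.
Qed.

Lemma bar_x5 w m i j V : linear_fun m -> bar w m (x5 i j * V) = w (i, j) * m V.
Proof. exact: bar_letter. Qed.

Lemma lin_sum l (J : Type) (s : seq J) (P : pred J) (F : J -> series k gen5) :
  linear_fun l -> l (\sum_(j <- s | P j) F j) = \sum_(j <- s | P j) l (F j).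
Proof.
by move=> H; elim/big_rec2: _ => [|j a f _ IH]; rewrite ?lin0 // linD // IH.
Qed.

Lemma kills_relator l r V : integrable l -> p5_relator r -> l (r * V) = 0.
Proof.
case=> -[lin _ Hs Hd HS] Hc [i j|i|i|i j m h D].
- by rewrite mulrBl linB // Hs subrr.
- by rewrite Hd.
- by rewrite HS.
- exact: (Hc (i, j) (m, h)).
Qed.

Lemma kills_gen l U r V : integrable l -> p5_relator r -> l (U * r * V) = 0.
Proof.
by move=> Hl Hr; case: (Hl) => -[_ -> //]; rewrite (kills_relator V Hl Hr) mulr0.
Qed.

Lemma preint_bar w m : admissible w -> integrable m -> preint (bar w m).
Proof.
move=> [Ws Wd WS] Hm; have [[lin _ _ _ _] _] := Hm.
split=> [|U r V Hr|i j V|i V|i V].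
- exact: bar_lin.
- rewrite /bar mulr_sumr; apply: eq_bigr => c _.
  rewrite -mulrA lquoM lin [lquo c U * _]mulrA (kills_gen _ _ Hm Hr) addr0.
  by rewrite mulrCA.
- by rewrite !bar_x5 // Ws.
- by rewrite bar_x5 // Wd mul0r.
- rewrite mulr_suml lin_sum; last exact: bar_lin.
  under eq_bigr do rewrite bar_x5 //.
  by rewrite -mulr_suml WS mul0r.
Qed.

Lemma preint_add l m : preint l -> preint m -> preint (l + m).
Proof.
case=> a1 a2 a3 a4 a5 [b1 b2 b3 b4 b5]; split=> [a f g|U r V Hr|i j V|i V|i V]; rewrite !fnlD.
- by rewrite a1 b1 mulrDr addrACA.
- by rewrite a2 // b2 // mulrDr.
- by rewrite a3 b3.
- by rewrite a4 b4 addr0.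
- by rewrite a5 b5 addr0.
Qed.

Lemma preint_opp l : preint l -> preint (- l).
Proof.
case=> a1 a2 a3 a4 a5; split=> [a f g|U r V Hr|i j V|i V|i V]; rewrite !fnlN.
- by rewrite a1 opprD mulrN.
- by rewrite a2 // mulrN.
- by rewrite a3.
- by rewrite a4 oppr0.
- by rewrite a5 oppr0.
Qed.

Lemma comm_bar w m c d V : linear_fun m ->
  bar w m (bracket (x5 c.1 c.2) (x5 d.1 d.2) * V) =
  w c * m (letter k d * V) - w d * m (letter k c * V).
Proof.
move=> H; rewrite /bracket mulrBl linB -?mulrA; last exact: bar_lin.
by rewrite !bar_x5 // /x5 -!surjective_pairing.
Qed.

Lemma integrable_eps : integrable (eps (k := k)).
Proof.
have nil0 U r V : p5_relator r -> (U * r * V) [::] = 0.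
  move=> Hr; suff -> : (U * r * V) [::] = U [::] * r [::] * V [::].
    suff -> : r [::] = 0 by rewrite mulr0 mul0r.
    case: Hr => [i j|i|i|i j m h D].
    - exact: subr0.
    - by [].
    - rewrite (_ : (\sum_j _) [::] = \sum_(j < 5) x5 i j [::]); first by rewrite big1.
      by elim/big_rec2: _ => // j a f _ <-.
    - have -> : bracket (x5 i j) (x5 m h) [::] =
        (x5 i j * x5 m h) [::] - (x5 m h * x5 i j) [::] by [].
      by rewrite !mul_nil !mul0r subrr.
  by rewrite -!mul_nil.
have nil1 r V : p5_relator r -> (r * V) [::] = 0.
  by move=> Hr; rewrite -[r]mul1r nil0.
split; first split.
- by move=> a f g.
- by move=> U r V Hr; rewrite /eps nil0 // nil1 // mulr0.
- by move=> i j V; rewrite /eps !mul_nil !mul0r.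
- by move=> i V; apply/nil1/p5_diag.
- by move=> i V; apply/nil1/p5_sum.
- by move=> c d V D; apply/nil1/p5_comm.
Qed.

Lemma barN w l : bar w (- l) = - bar w l.
Proof.
apply/funext => f; rewrite fnlN /bar -sumrN.
by apply: eq_bigr => c _; rewrite fnlN mulrN.
Qed.

Lemma foldl_lin p q l0 a : linear_fun l0 ->
  linear_fun (foldl (fun l n => iter n.-1 (bar p) (bar q l)) l0 a).
Proof.
elim: a l0 => //= n a IH l0 H; apply: IH.
by elim: n.-1 => [|n' IH] /=; exact: bar_lin.
Qed.

Lemma polylog1_nil p q : polylog1 p q [::] = eps (k := k).
Proof. by apply/funext => f; rewrite /polylog1 /= expr0 mul1r. Qed.

Lemma bar_sign w (s : nat) l :
  bar w (fun f => (-1) ^+ s * l f) = (fun f => (-1) ^+ s * bar w l f).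
Proof.
apply/funext => f; rewrite /bar mulr_sumr; apply: eq_bigr => c _.
by rewrite mulrCA.
Qed.

Lemma polylog1_rcons p q a n : polylog1 p q (rcons a n.+2) =
  bar p (polylog1 p q (rcons a n.+1)).
Proof. by rewrite /polylog1 !size_rcons bar_sign !foldl_rcons. Qed.

Lemma polylog1_rcons1 p q a : polylog1 p q (rcons a 1) = - bar q (polylog1 p q a).
Proof.
rewrite /polylog1 size_rcons bar_sign foldl_rcons /=.
by apply/funext => f; rewrite exprS mulN1r mulNr.
Qed.

Lemma positive_rcons a n : positive (rcons a n) = (0 < n)%N && positive a.
Proof. by rewrite /positive all_rcons. Qed.

Lemma sumn_rcons a n : sumn (rcons a n) = (sumn a + n)%N.
Proof. by rewrite -cats1 sumn_cat /= addn0. Qed.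

Lemma init_rcons a n : init (rcons a n) = a.
Proof. by rewrite /init size_rcons -cats1 take_size_cat. Qed.

Lemma decr_last_rcons a n : decr_last (rcons a n) = rcons a n.-1.
Proof. by rewrite /decr_last init_rcons last_rcons. Qed.

Lemma lin_polylog1 p q a : linear_fun (polylog1 p q a).
Proof.
move=> c f g; rewrite /polylog1 foldl_lin // mulrDr; congr (_ + _).
by rewrite mulrCA.
Qed.

Definition pl1 := (polylog1_rcons, polylog1_rcons1).

Lemma integrable_polylog1 p q a : admissible p -> admissible q ->
  wedge0 p q -> positive a -> integrable (polylog1 p q a).
Proof.
move=> Hp Hq Hw; move: {2}(sumn a) (leqnn (sumn a)) => N.
have lin b := lin_polylog1 p q b.
elim: N a => [|N IH] a; case/lastP: a => [|a n].
- by rewrite polylog1_nil => *; exact: integrable_eps.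
- by rewrite sumn_rcons positive_rcons; case: n => // n; rewrite addnS.
- by rewrite polylog1_nil => *; exact: integrable_eps.
rewrite sumn_rcons positive_rcons; case: n => // n; rewrite addnS ltnS => leN /= Ha.
case: n leN => [|n] leN.
  rewrite addn0 in leN; rewrite polylog1_rcons1; split.
    by apply/preint_opp/preint_bar; last exact: IH.
  move=> c d V D; rewrite fnlN comm_bar //.
  case/lastP: a Ha leN => [|a n] Ha leN.
    by rewrite polylog1_nil /eps !mul_nil !mul0r !mulr0 subrr oppr0.
  move: Ha; rewrite positive_rcons; case: n leN => // -[|n] leN Ha; rewrite pl1.
    by rewrite !fnlN !bar_letter // !mulrN !mulrA [q d * _]mulrC subrr oppr0.
  rewrite !bar_letter //.
  transitivity (wedge p q c d * polylog1 p q (rcons a n.+1) V).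
    by rewrite /wedge; ring.
  by rewrite Hw // mul0r.
rewrite polylog1_rcons; split.
  by apply/preint_bar => //; apply: IH; rewrite ?sumn_rcons ?positive_rcons.
move=> c d V D; rewrite comm_bar //; case: n leN => [|n] leN; rewrite pl1.
  rewrite !fnlN !bar_letter //.
  transitivity (- wedge p q c d * polylog1 p q a V); first by rewrite /wedge; ring.
  by rewrite Hw // oppr0 mul0r.
rewrite !bar_letter //; ring.
Qed.


Section Polylog2.
Variables w12 w45 w23 w34 w24 : form.
Hypotheses (A12 : admissible w12) (A45 : admissible w45) (A23 : admissible w23).
Hypotheses (A34 : admissible w34) (A24 : admissible w24).
Hypotheses (W1 : wedge0 w12 w23) (W2 : wedge0 w45 w34).
Hypothesis (W3 : wedge0 (w12 + w45) w24).
Hypothesis (W4 : forall c d, disjoint5 c d ->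
  wedge w23 w34 c d + wedge (w12 - w23) w24 c d + wedge w34 w24 c d = 0).

Local Notation L := (polylog2 w12 w45 w23 w34 w24).
Local Notation X := (polylogX w12 w23).
Local Notation Y := (polylogY w45 w34).
Local Notation E24 := (polylog1 (w12 + w45) w24).
Local Notation E34 := (polylog1 w45 w34).

Lemma polylog2_nil b : L [::] b = E34 b.
Proof. by rewrite /polylog2; case: (_ + _)%N. Qed.

Lemma polylog2_nilr a : L a [::] = E24 a.
Proof.
case: a => [|n a]; first by rewrite polylog2_nil !polylog1_nil.
by rewrite /polylog2; case: (_ + _)%N.
Qed.

Lemma polylog2E a b : a != [::] -> b != [::] -> positive a -> positive b ->
  L a b = X L a b + Y L a b.
Proof.
case/lastP: a => [|a m]; case/lastP: b => [|b n] // _ _.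
rewrite !positive_rcons => /andP[m0 Ha] /andP[n0 Hb].
have szr (c : seq nat) i : nilp (rcons c i) = false by rewrite /nilp size_rcons.
have recE N a0 b0 : N = (sumn a0 + sumn b0)%N ->
  polylog2_rec w12 w45 w23 w34 w24 N a0 b0 = L a0 b0 by move->.
rewrite {1}/polylog2; case: m m0 => // m _.
rewrite sumn_rcons addnS addSn /= !szr.
rewrite /polylogX /polylogY !last_rcons !decr_last_rcons !init_rcons /=.
congr (_ + _).
  case: m => [|m] /=; last by rewrite recE // !sumn_rcons addnS addSn.
  rewrite !recE ?addn0 //.
  by case: (b) => [|b0 b'] /=; rewrite !sumn_rcons /= ?addn0 // -addnA.
case: n n0 => // -[|n] _ /=; rewrite recE // !sumn_rcons.
  by rewrite addn1 ?addnS ?addSn.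
by rewrite ?addnS ?addSn.
Qed.


Lemma lin_polylog2 a b : linear_fun (L a b).
Proof.
rewrite /polylog2; move: (sumn a + sumn b)%N => N; elim: N a b => [|N IH] a b /=;
  (case: (nilp a); first exact: lin_polylog1);
  (case: (nilp b); first exact: lin_polylog1).
- by move=> c f g; rewrite mulr0 addr0.
- rewrite /polylogX /polylogY; apply: add_lin; case: ifP => _;
  do ?[apply: add_lin | apply: opp_lin]; exact: bar_lin.
Qed.

Let lin a b := @lin_polylog2 a b.

Lemma positive_behead a : positive a -> positive (behead a).
Proof. by case: a => //= n a /andP[]. Qed.

Lemma polylog2_rcons a b (m n : nat) (b1 := rcons b n.+1) :
    positive a -> positive b ->
  L (rcons a m.+1) b1 =
    (if m is m'.+1 then bar w12 (L (rcons a m) b1) else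
       - bar w23 (L a b1) - bar (w12 - w23) (L (rcons a (head 0%N b1)) (behead b1)))
    + (if n is n'.+1 then bar w45 (L (rcons a m.+1) (rcons b n))
       else - bar w34 (L (rcons a m.+1) b)).
Proof.
move=> Ha Hb; rewrite {}/b1 polylog2E ?positive_rcons ?Ha ?Hb -?size_eq0 ?size_rcons //.
rewrite /polylogX /polylogY !last_rcons !decr_last_rcons !init_rcons.
by case: m n => [|m] [|n].
Qed.

Lemma polylog2_Y a b n V : positive a -> positive b -> exists u v, forall d : gen5,
  L a (rcons b n.+1) (letter k d * V) = w12 d * u + w23 d * v
    + (if n is n'.+1 then w45 d * L a (rcons b n) V else - (w34 d * L a b V)).
Proof.
move=> Ha Hb; case/lastP: a Ha => [|a m] Ha.
  exists 0, 0 => d; rewrite !mulr0 !add0r !polylog2_nil.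
  by case: n => [|n]; rewrite pl1 ?fnlN bar_letter // => *; exact: lin_polylog1.
move: Ha; rewrite positive_rcons; case: m => // m /= Ha.
rewrite polylog2_rcons //.
case: m => [|m].
  set b1 := rcons b _.
  exists (- L (rcons a (head 0%N b1)) (behead b1) V).
  exists (L (rcons a (head 0%N b1)) (behead b1) V - L a b1 V) => d.
  case: n @b1 => [|n] b1; rewrite !(fnlD, fnlN) !bar_letter //;
    by rewrite (_ : (w12 - w23) d = w12 d - w23 d) //; ring.
exists (L (rcons a m.+1) (rcons b n.+1) V), 0 => d.
by case: n => [|n]; rewrite !(fnlD, fnlN) !bar_letter // mulr0 addr0.
Qed.

Lemma polylog2_X a (m : nat) b V : b != [::] -> positive a -> positive b ->
  exists u v, forall d : gen5,
  L (rcons a m.+1) b (letter k d * V) =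
   (if m is m'.+1 then w12 d * L (rcons a m) b V else
      - (w23 d * L a b V) - (w12 d - w23 d) *
         L (rcons a (head 0%N b)) (behead b) V) + w45 d * u + w34 d * v.
Proof.
case/lastP: b => // b n _ Ha; rewrite positive_rcons; case: n => // n /= Hb.
rewrite polylog2_rcons //; set b1 := rcons b _.
have e (d : gen5) : (w12 - w23) d = w12 d - w23 d by [].
case: n @b1 => [|n] b1.
  exists 0, (- L (rcons a m.+1) b V) => d; rewrite mulr0 addr0 mulrN.
  by case: m => [|m]; rewrite !(fnlD, fnlN) !bar_letter // e.
exists (L (rcons a m.+1) (rcons b n.+1) V), 0 => d; rewrite mulr0 addr0.
by case: m => [|m]; rewrite !(fnlD, fnlN) !bar_letter // e.
Qed.

Lemma E24_rcons a (m : nat) (d : gen5) V : E24 (rcons a m.+1) (letter k d * V) =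
  if m is m'.+1 then (w12 d + w45 d) * E24 (rcons a m) V else - (w24 d * E24 a V).
Proof.
by case: m => [|m]; rewrite pl1 ?fnlN bar_letter // => *; exact: lin_polylog1.
Qed.

Lemma commint_polylog2 a b (m n : nat) : positive a -> positive b ->
  commint (L (rcons a m.+1) (rcons b n.+1)).
Proof.
move=> Ha Hb c d V D.
have := W1 D; have := W2 D; have := W3 D; have := W4 D; rewrite /wedge => h4 h3 h2 h1.
have e (x : gen5) : (w12 - w23) x = w12 x - w23 x by [].
have e' (x : gen5) : (w12 + w45) x = w12 x + w45 x by [].
rewrite !e in h4; rewrite !e' in h3.
have nr (s : seq nat) i : rcons s i != [::] by rewrite -size_eq0 size_rcons.
have pr (s : seq nat) i : positive s -> positive (rcons s i.+1)
  by move=> Hs; rewrite positive_rcons.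
have comb x y z : (w12 c * w23 d - w12 d * w23 c) * x
    + (w45 c * w34 d - w45 d * w34 c) * y
    + (w23 c * w34 d - w23 d * w34 c
       + ((w12 c - w23 c) * w24 d - (w12 d - w23 d) * w24 c)
       + (w34 c * w24 d - w34 d * w24 c)) * z = 0.
  by rewrite h1 h2 h4 !mul0r !addr0.
have pc i (s : seq nat) : positive (i :: s) -> (0 < i)%N /\ positive s by move/andP.
rewrite polylog2_rcons // fnlD.
case: m => [|m]; case: n => [|n]; rewrite ?(fnlD, fnlN) !comm_bar // ?e.
- have [u [v Ea]] := @polylog2_Y a b 0 V Ha Hb; rewrite !Ea {Ea}.
  case: b Hb => [|b0 b] Hb /=.
    rewrite !polylog2_nilr !(E24_rcons a 0).
    rewrite -[RHS](comb u 0 (E24 a V)); ring.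
  have [b0p Hb'] := pc _ _ Hb; case: b0 b0p Hb => // b0 _ Hb.
  have [u1 [v1 E1]] := @polylog2_Y (rcons a b0.+1) b 0 V (pr _ _ Ha) Hb'.
  have [u2 [v2 E2]] := @polylog2_X a 0 (b0.+1 :: b) V isT Ha Hb.
  rewrite !E1 !E2 /=.
  rewrite -[RHS](comb (u - u1 - v1) u2 0); ring.
- have [u [v Ea]] := @polylog2_Y a b n.+1 V Ha Hb; rewrite !Ea {Ea}.
  have [u2 [v2 E2]] := @polylog2_X a 0 (rcons b n.+1) V (nr _ _) Ha (pr _ _ Hb).
  rewrite !E2 {E2}; case: b Hb => [|b0 b] Hb /=.
    rewrite !polylog2_nilr !(E24_rcons a n.+1).
    rewrite -[RHS](comb (u - E24 (rcons a n.+1) V) v2 0); ring.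
  have [b0p Hb'] := pc _ _ Hb; case: b0 b0p Hb => // b0 _ Hb.
  have [u1 [v1 E1]] := @polylog2_Y (rcons a b0.+1) b n.+1 V (pr _ _ Ha) Hb'.
  rewrite !E1; rewrite -[RHS](comb (u - u1 - v1) v2 0); ring.
- have [u [v Ea]] := @polylog2_Y (rcons a m.+1) b 0 V (pr _ _ Ha) Hb.
  rewrite !Ea {Ea}; case: b Hb => [|b0 b] Hb.
    rewrite !polylog2_nilr !(E24_rcons a m.+1).
    rewrite -[RHS](comb v (E24 (rcons a m.+1) V) 0); ring.
  have [u2 [v2 E2]] := @polylog2_X a m.+1 (b0 :: b) V isT Ha Hb.
  rewrite !E2; rewrite -[RHS](comb v u2 0); ring.
- have [u [v Ea]] := @polylog2_Y (rcons a m.+1) b n.+1 V (pr _ _ Ha) Hb.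
  have [u2 [v2 E2]] := @polylog2_X a m.+1 (rcons b n.+1) V (nr _ _) Ha (pr _ _ Hb).
  rewrite !Ea !E2; rewrite -[RHS](comb v v2 0); ring.
Qed.

Lemma admissibleD w w' : admissible w -> admissible w' -> admissible (w + w').
Proof.
move=> [a1 a2 a3] [b1 b2 b3]; have e c : (w + w') c = w c + w' c by [].
split=> [i j|i|i]; first by rewrite !e a1 b1.
  by rewrite e a2 b2 addr0.
by under eq_bigr do rewrite e; rewrite big_split /= a3 b3 addr0.
Qed.

Lemma admissibleN w : admissible w -> admissible (- w).
Proof.
move=> [a1 a2 a3]; have e c : (- w) c = - w c by [].
split=> [i j|i|i]; first by rewrite !e a1.
  by rewrite e a2 oppr0.
by under eq_bigr do rewrite e; rewrite sumrN a3 oppr0.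
Qed.

Lemma integrable_polylog2 a b : positive a -> positive b -> integrable (L a b).
Proof.
move: {2}(sumn a + sumn b)%N (leqnn (sumn a + sumn b)) => N.
elim: N a b => [|N IH] a b; case/lastP: a => [|a m]; case/lastP: b => [|b n];
  rewrite ?polylog2_nil ?polylog2_nilr => leN Ha Hb;
  try by apply: integrable_polylog1 => //; exact: admissibleD.
  by move: leN Ha; rewrite sumn_rcons positive_rcons; case: m => // m; rewrite addnS.
have pr (s : seq nat) i : positive s -> positive (rcons s i.+1)
  by move=> Hs; rewrite positive_rcons.
move: leN Ha Hb; rewrite !sumn_rcons !positive_rcons.
case: m => // m; case: n => // n /= leN Ha Hb.
split; last exact: commint_polylog2.
have A1223 : admissible (w12 - w23) by apply: admissibleD => //; exact: admissibleN.
have head_behead : (sumn (rcons a (head 0 (rcons b n.+1)))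
    + sumn (behead (rcons b n.+1)) = sumn a + (sumn b + n.+1))%N.
  by rewrite -(sumn_rcons b); case: (rcons b _) => [|i s]; rewrite sumn_rcons /=; lia.
have posh : positive (rcons a (head 0%N (rcons b n.+1))).
  by case: b Hb {leN head_behead} => [|[|i] s] //= Hb; apply: pr.
rewrite polylog2_rcons //; apply: preint_add.
  case: m leN => [|m] leN.
    apply: preint_add; apply/preint_opp/preint_bar => //; apply: IH => //.
    - by rewrite sumn_rcons; lia.
    - exact: pr.
    - by rewrite head_behead; lia.
    - exact/positive_behead/pr.
  apply: preint_bar => //; apply: IH; [|exact: pr|exact: pr].
  by rewrite !sumn_rcons; lia.
case: n leN {head_behead posh} => [|n] leN.
  apply/preint_opp/preint_bar => //; apply: IH => //; last exact: pr.
  by rewrite !sumn_rcons; lia.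
apply: preint_bar => //; apply: IH; [|exact: pr|exact: pr].
by rewrite !sumn_rcons; lia.
Qed.

End Polylog2.

Definition degree_fun l N : Prop := forall f, l f = l (homog N f).

Lemma lquo_homog (c : gen5) N f : lquo c (homog N.+1 f) = homog N (lquo c f).
Proof. by []. Qed.

Lemma bar_degree w l N : degree_fun l N -> degree_fun (bar w l) N.+1.
Proof. by move=> H f; apply: eq_bigr => c _; rewrite lquo_homog -H. Qed.

Lemma add_degree l m N : degree_fun l N -> degree_fun m N -> degree_fun (l + m) N.
Proof. by move=> Hl Hm f; rewrite !fnlD -Hl -Hm. Qed.

Lemma opp_degree l N : degree_fun l N -> degree_fun (- l) N.
Proof. by move=> Hl f; rewrite !fnlN -Hl. Qed.

Lemma polylog1_degree p q a : positive a -> degree_fun (polylog1 p q a) (sumn a).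
Proof.
move: {2}(sumn a) (leqnn (sumn a)) => N.
elim: N a => [|N IH] a; case/lastP: a => [|a [|[|n]]]; rewrite ?polylog1_nil //
  ?positive_rcons ?sumn_rcons => leN //= Ha; first by lia.
- by lia.
- by rewrite pl1 addn1; apply/opp_degree/bar_degree/IH => //; lia.
- rewrite pl1 addnS -sumn_rcons; apply/bar_degree/IH; rewrite ?positive_rcons //.
  by rewrite sumn_rcons; lia.
Qed.

Lemma polylog2_degree w12 w45 w23 w34 w24 a b : positive a -> positive b ->
  degree_fun (polylog2 w12 w45 w23 w34 w24 a b) (sumn a + sumn b).
Proof.
move: {2}(sumn a + sumn b)%N (leqnn (sumn a + sumn b)) => N.
elim: N a b => [|N IH] a b; case/lastP: a => [|a m]; case/lastP: b => [|b n];
  rewrite ?polylog2_nil ?polylog2_nilr => leN Ha Hb;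
  try by rewrite /= ?addn0; apply: polylog1_degree.
  by move: leN Ha; rewrite sumn_rcons positive_rcons; case: m => // m; rewrite addnS.
have pr (s : seq nat) i : positive s -> positive (rcons s i.+1)
  by move=> Hs; rewrite positive_rcons.
move: leN Ha Hb; rewrite !sumn_rcons !positive_rcons.
case: m => // m; case: n => // n /= leN Ha Hb.
have posh : positive (rcons a (head 0%N (rcons b n.+1))).
  by case: b Hb {leN} => [|[|i] s] //= Hb; apply: pr.
have head_behead : (sumn (rcons a (head 0 (rcons b n.+1)))
    + sumn (behead (rcons b n.+1)) = sumn a + (sumn b + n.+1))%N.
  by rewrite -(sumn_rcons b); case: (rcons b _) => [|i s]; rewrite sumn_rcons /=; lia.
have bd w l M : degree_fun l M -> M.+1 = (sumn a + m.+1 + (sumn b + n.+1))%N ->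
    degree_fun (bar w l) (sumn a + m.+1 + (sumn b + n.+1)).
  by move=> H <-; exact: bar_degree.
rewrite polylog2_rcons //; apply: add_degree.
  case: m leN bd => [|m] leN bd.
    apply: add_degree; apply: opp_degree; apply: bd.
    - by apply: IH => //; [rewrite sumn_rcons; lia | exact: pr].
    - by rewrite sumn_rcons; lia.
    - by apply: IH => //; [rewrite head_behead; lia | exact/positive_behead/pr].
    - by rewrite head_behead; lia.
  apply: bd; first by apply: IH; rewrite ?sumn_rcons; [lia|exact: pr|exact: pr].
  by rewrite !sumn_rcons; lia.
case: n leN bd {head_behead posh} => [|n] leN bd.
  apply: opp_degree; apply: bd.
    by apply: IH => //; [rewrite sumn_rcons; lia | exact: pr].
  by rewrite !sumn_rcons; lia.
apply: bd; first by apply: IH; rewrite ?sumn_rcons; [lia|exact: pr|exact: pr].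
by rewrite !sumn_rcons; lia.
Qed.

Lemma descent l N f g : integrable l -> degree_fun l N ->
  f = g %[mod Up5 k] -> l f = l g.
Proof.
move=> Hl HN /eqP; rewrite -Quotient.idealrBE => /asboolP /(_ N) H.
have lin : linear_fun l by case: Hl => -[].
apply/eqP; rewrite -subr_eq0 -linB // HN; elim: H => [U r V Hr|f' g' _ H1 _ H2].
  by rewrite kills_gen.
by rewrite linD // (eqP H1) (eqP H2) addr0.
Qed.

Lemma cross_ratio_wedge (c d : gen5) (o45 := cross_ratio 4 5 3 1)
    (o34 := cross_ratio 3 4 1 5) (o24 := cross_ratio 2 4 1 5)
    (o12 := cross_ratio 1 2 5 3) (o23 := cross_ratio 2 3 1 5) :
  disjoint5 c d ==>
  [&& o45 c * o34 d - o45 d * o34 c == 0, o12 c * o23 d - o12 d * o23 c == 0,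
      (o45 c + o12 c) * o24 d - (o45 d + o12 d) * o24 c == 0
    & o34 c * o23 d - o34 d * o23 c
        + ((o45 c - o34 c) * o24 d - (o45 d - o34 d) * o24 c)
        + (o23 c * o24 d - o23 d * o24 c) == 0].
Proof.
rewrite {}/o45 {}/o34 {}/o24 {}/o12 {}/o23; case: c d => [i j] [m h].
by elim/ord5_ind: i; elim/ord5_ind: j; elim/ord5_ind: m; elim/ord5_ind: h; vm_compute.
Qed.

Lemma omega_wedge (c d : gen5) (o45 := omega45 k) (o34 := omega34 k)
    (o24 := omega24 k) (o12 := omega12 k) (o23 := omega23 k) : disjoint5 c d ->
  [/\ wedge o45 o34 c d = 0, wedge o12 o23 c d = 0, wedge (o45 + o12) o24 c d = 0
    & wedge o34 o23 c d + wedge (o45 - o34) o24 c d + wedge o23 o24 c d = 0].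
Proof.
move=> /(implyP (cross_ratio_wedge c d)) /and4P[/eqP h1 /eqP h2 /eqP h3 /eqP h4].
have eD w w' x : (w + w') x = w x + w' x :> k by [].
have eN w x : (- w) x = - w x :> k by [].
rewrite /wedge !(eD, eN) /o45 /o34 /o24 /o12 /o23.
rewrite /omega45 /omega34 /omega24 /omega12 /omega23.
by split; rewrite -?(rmorphM, rmorphB, rmorphD) ?(h1, h2, h3, h4).
Qed.

End Descent.

Section FunctionalsUp5.
Variable k : fieldType.

Definition l_xy (a b : seq nat) : functional k :=
  polylog2 (omega12 k) (omega45 k) (omega23 k) (omega34 k) (omega24 k) a b.

Definition l_yx (a b : seq nat) : functional k :=
  polylog2 (omega45 k) (omega12 k) (omega34 k) (omega23 k) (omega24 k) a b.

(* For the integrable [l] this is the induced functional, see [l_yx_descends]. *)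
Definition on_Up5 (l : functional k) (u : Up5 k) : k := l (repr u).

Lemma l_yx_descends (a b : seq nat) (f : series k gen5) :
  positive a -> positive b -> on_Up5 (l_yx a b) (\pi_(Up5 k) f) = l_yx a b f.
Proof.
move=> Ha Hb; have W := @omega_wedge k; have adm := @omega_admissible k.
apply: (@descent k _ (sumn a + sumn b)); last by rewrite reprK.
  apply: integrable_polylog2 => //; [exact: (adm 0)|exact: (adm 3)|exact: (adm 1)
    |exact: (adm 4)|exact: (adm 2)|..]; by move=> c d /W[].
exact: polylog2_degree.
Qed.

Definition is_index (a : seq nat) : bool := (a != [::]) && positive a.

End FunctionalsUp5.

(* Main.v *)
Require Import Defs.
From mathcomp Require Import all_boot all_order all_algebra.
From mathcomp Require Import boolp functions ring zify.

(** Both conditions bear on the coefficients of [psi] at the words ending in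
    x_1, that is, at the words in y_1, y_2, and so on.  An index (a_1, ..., a_k)
    is coded as the word [a_k - 1; ...; a_1 - 1] in the letters of [pi_Y]
    ([index_of] undoes this coding): the entry attached to the largest summation
    variable of the polylogarithm comes first, and the indices with all entries
    equal to 1 become the words of zeros.

    Harmonic side.  Delta_* is dual to the quasi-shuffle product [qshuffle], so
    that [psi] is in dmr_0 iff psi_* vanishes on the quasi-shuffle of any two
    nonempty words ([Delta_star_primitive]).  If the two words are not both
    powers of y_1, then no power of y_1 occurs in their quasi-shuffle and psi_*
    may be replaced by pi_Y(psi).  If both are, the relation follows from the
    others, because the quasi-shuffle of y_1 and y_1^n consists of n+1 times
    y_1^(n+1) and of words that are not powers of y_1, the values of psi_corr
    being those that make this work ([all_qshuffle_relations]).  Hence dmr_0 amounts to the relations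
    [dmr0_relations].

    Pentagon side.  Each psi_ijk is a series in two letters, on which l^{y,x} is
    computed by restricting the five forms to these letters.  When the entries
    are not all 1, it vanishes on psi_123, psi_432 and psi_543, and its value on
    psi_215 is the coefficient of [psi] at the concatenation of the two indices.
    So condition (ii) says that the remaining value, [defect_451], on psi_451 is
    equal to this coefficient ([l_yx_defect]).

    The link is the expansion of Li_a(x) Li_b(y) as a sum over quasi-shuffles,
    where each term is a polylogarithm in (x,y), (xy) or (y,x) according to which
    variables carry the largest summation index.  Restricted to the letters of
    psi_451 the terms of the first two kinds are mere coefficients and those of
    the third kind are values of [defect_451], while the product becomes a
    shuffle product, on which Lie series vanish ([split_G_shuffle]).  Replacing
    [defect_451] by its expected value in this expansion gives the quasi-shuffle
    sum of [psi].  Therefore the quasi-shuffle sum of a and b is minus the sum of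
    the differences H(c, e) between [defect_451] and its expected value, over
    the ways to write a = e ++ a' and the c in the quasi-shuffle of a' and b that
    start in b.  The only term with e = a is H(b, a), so that this system is
    triangular ([sum_split_last]): all the differences vanish iff all the
    quasi-shuffle sums do ([defect_relations]). *)

Set Implicit Arguments.
Unset Strict Implicit.
Unset Printing Implicit Defensive.

Import GRing.Theory.
Local Open Scope ring_scope.

(** * Shuffles and Lie series *)

Section Shuffle.
Variable I : Type.
Implicit Types u v w : seq I.

Fixpoint shuffle u : seq I -> seq (seq I) :=
  if u is x :: u' then
    fix shuffle_u v :=
      if v is y :: v' then
        map (cons x) (shuffle u' v) ++ map (cons y) (shuffle_u v')
      else [:: u]
  else fun v => [:: v].

Arguments shuffle : simpl never.

Lemma shuffle_cons x u y v : shuffle (x :: u) (y :: v) =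
  map (cons x) (shuffle u (y :: v)) ++ map (cons y) (shuffle (x :: u) v).
Proof. by []. Qed.

Lemma shuffle_nilr u : shuffle u [::] = [:: u].
Proof. by case: u. Qed.

Fixpoint deconcat w : seq (seq I * seq I) :=
  ([::], w) :: (if w is x :: w' then
    [seq (x :: p.1, p.2) | p <- deconcat w'] else [::]).

Variable k : comNzRingType.
Implicit Types (h : seq I -> seq I -> k) (f g : series k I).

Lemma sum_deconcat_cons x w h : \sum_(p <- deconcat (x :: w)) h p.1 p.2 =
  h [::] (x :: w) + \sum_(p <- deconcat w) h (x :: p.1) p.2.
Proof. by rewrite big_cons big_map. Qed.

Lemma smul_deconcat f g w : (f * g) w = \sum_(p <- deconcat w) f p.1 * g p.2.
Proof.
rewrite -[f * g]/(smul f g); elim: w f => [|x w IH] f.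
  by rewrite smul_nil big_seq1.
by rewrite smul_cons IH (sum_deconcat_cons _ _ (fun a b => f a * g b)).
Qed.

Lemma sum_shuffle_cons x u y v (f : seq I -> k) :
  \sum_(w <- shuffle (x :: u) (y :: v)) f w =
  \sum_(w <- shuffle u (y :: v)) f (x :: w) +
  \sum_(w <- shuffle (x :: u) v) f (y :: w).
Proof. by rewrite shuffle_cons big_cat !big_map. Qed.

(** Deconcatenation is a morphism for the shuffle product. It follows that the
    shuffle coproduct of a product of series is the product of the coproducts. *)
Lemma deconcat_shuffle u v h :
  \sum_(w <- shuffle u v) \sum_(p <- deconcat w) h p.1 p.2 =
  \sum_(p <- deconcat u) \sum_(q <- deconcat v)
    \sum_(w1 <- shuffle p.1 q.1) \sum_(w2 <- shuffle p.2 q.2) h w1 w2.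
Proof.
elim: u v h => [|x u IHu] v h.
  by rewrite !big_seq1; apply: eq_bigr => p _; rewrite !big_seq1.
elim: v h => [|y v IHv] h.
  rewrite shuffle_nilr big_seq1; apply: eq_bigr => p _.
  by rewrite big_seq1 /= !shuffle_nilr !big_seq1.
rewrite sum_shuffle_cons.
under eq_bigr do rewrite sum_deconcat_cons.
under [in X in _ + X]eq_bigr do rewrite sum_deconcat_cons.
rewrite !big_split /= (IHu _ (fun a b => h (x :: a) b)).
rewrite (IHv (fun a b => h (y :: a) b)).
pose H a b c d := \sum_(w1 <- shuffle a b) \sum_(w2 <- shuffle c d) h w1 w2.
rewrite -/(deconcat (y :: v)) -/(deconcat (x :: u)).
rewrite [RHS](sum_deconcat_cons x u
  (fun a b => \sum_(q <- deconcat (y :: v)) H a q.1 b q.2)).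
rewrite (sum_deconcat_cons y v (fun c d => H [::] c (x :: u) d)).
under [X in _ = _ + X]eq_bigr => p _ do
  rewrite (sum_deconcat_cons y v (fun c d => H (x :: p.1) c p.2 d)).
rewrite big_split /=.
rewrite [X in _ + _ + (_ + X)](sum_deconcat_cons x u (fun a b => \sum_(q <- deconcat v)
  \sum_(w1 <- shuffle a q.1) \sum_(w2 <- shuffle b q.2) h (y :: w1) w2)).
(* What is left are the cuts where both [x] and [y] fall on the left. *)
have -> : \sum_(p <- deconcat u) \sum_(q <- deconcat v) H (x :: p.1) (y :: q.1) p.2 q.2 =
  \sum_(p <- deconcat u) \sum_(q <- deconcat v)
    \sum_(w1 <- shuffle p.1 (y :: q.1)) \sum_(w2 <- shuffle p.2 q.2) h (x :: w1) w2 +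
  \sum_(p <- deconcat u) \sum_(q <- deconcat v)
    \sum_(w1 <- shuffle (x :: p.1) q.1) \sum_(w2 <- shuffle p.2 q.2) h (y :: w1) w2.
  rewrite -big_split; apply: eq_bigr => p _; rewrite -big_split; apply: eq_bigr => q _.
  exact: sum_shuffle_cons.
under [X in _ + X + _ = _]eq_bigr => p _ do
  rewrite (sum_deconcat_cons y v (fun c d => \sum_(w1 <- shuffle p.1 c)
     \sum_(w2 <- shuffle p.2 d) h (x :: w1) w2)).
rewrite big_split /=.
have H0 a b c : H [::] a b c = \sum_(w <- shuffle b c) h a w by rewrite /H big_seq1.
rewrite !H0 sum_shuffle_cons.
under [X in _ = _ + X + _]eq_bigr do rewrite H0.
under [X in _ = _ + (X + _)]eq_bigr do rewrite /H shuffle_nilr big_seq1.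
under [X in _ + (X + _) + _ = _]eq_bigr do rewrite shuffle_nilr big_seq1.
under [X in _ + (_ + (X + _)) = _]eq_bigr do rewrite big_seq1.
rewrite /H; ring.
Qed.

(** Primitivity for the coproduct that makes the letters primitive; the value at
    the empty word is left free. *)
Definition primitive f : Prop :=
  forall x u y v, \sum_(w <- shuffle (x :: u) (y :: v)) f w = 0.

Lemma primitive0 : primitive 0.
Proof. by move=> *; rewrite big1. Qed.

Lemma primitiveD f g : primitive f -> primitive g -> primitive (f + g).
Proof. by move=> F G x u y v; rewrite big_split /= F G addr0. Qed.

Lemma primitiveZ a f : primitive f -> primitive (a *: f).
Proof. by move=> F x u y v; rewrite -mulr_sumr F mulr0. Qed.

Lemma sum_deconcat_nill w (h : seq I -> k) :
  \sum_(p <- deconcat w) (nilp p.1)%:R * h p.2 = h w.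
Proof.
case: w => [|x w]; first by rewrite big_seq1 mul1r.
by rewrite big_cons big_map big1 ?mul1r ?addr0 // => p _; rewrite mul0r.
Qed.

Lemma sum_deconcat_nilr w (h : seq I -> k) :
  \sum_(p <- deconcat w) h p.1 * (nilp p.2)%:R = h w.
Proof.
elim: w h => [|x w IH] h; first by rewrite big_seq1 mulr1.
by rewrite big_cons big_map /= mulr0 add0r (IH (fun a => h (x :: a))).
Qed.

Lemma sum_shuffle_primitive f u v : primitive f -> f [::] = 0 ->
  \sum_(w <- shuffle u v) f w = (nilp u)%:R * f v + f u * (nilp v)%:R.
Proof.
case: u v => [|x u] [|y v] F f0; rewrite /= ?mul1r ?mulr1 ?mul0r ?mulr0 ?addr0 ?add0r;
  by rewrite ?big_seq1 ?f0 ?addr0 ?F.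
Qed.

(** (f (x) 1 + 1 (x) f) (g (x) 1 + 1 (x) g) has f (x) g + g (x) f as its
    component on pairs of nonempty words; this is symmetric in f and g, whence
    the next lemma. *)
Lemma sum_shuffle_mul f g x u y v : f [::] = 0 -> g [::] = 0 ->
    primitive f -> primitive g ->
  \sum_(w <- shuffle (x :: u) (y :: v)) (f * g) w =
  f (x :: u) * g (y :: v) + f (y :: v) * g (x :: u).
Proof.
move=> f0 g0 F G; under eq_bigr do rewrite smul_deconcat.
rewrite (deconcat_shuffle _ _ (fun a b => f a * g b)).
transitivity (\sum_(p <- deconcat (x :: u)) \sum_(q <- deconcat (y :: v))
   ((nilp p.1)%:R * ((nilp p.2)%:R * (f q.1 * g q.2))
     + (nilp p.1)%:R * g p.2 * (f q.1 * (nilp q.2)%:R)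
     + f p.1 * (nilp p.2)%:R * ((nilp q.1)%:R * g q.2)
     + f p.1 * g p.2 * ((nilp q.1)%:R * (nilp q.2)%:R))).
  apply: eq_bigr => p _; apply: eq_bigr => q _.
  under eq_bigr do rewrite -mulr_sumr.
  by rewrite -mulr_suml !sum_shuffle_primitive //; ring.
under eq_bigr do rewrite !big_split -!mulr_sumr /=.
rewrite !big_split -!mulr_suml !sum_deconcat_nill !sum_deconcat_nilr /=.
rewrite (sum_deconcat_nill (y :: v) (fun a => (nilp a)%:R)).
rewrite (sum_deconcat_nill (x :: u) (fun a => (nilp a)%:R * \sum_(q <- _) _)).
by rewrite mul0r mulr0 (sum_deconcat_nilr (y :: v)) (sum_deconcat_nill (y :: v)); ring.
Qed.

Lemma primitive_bracket f g : f [::] = 0 -> g [::] = 0 ->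
  primitive f -> primitive g -> primitive (bracket f g).
Proof.
move=> f0 g0 F G x u y v; rewrite /bracket.
by rewrite sumrB !sum_shuffle_mul //; ring.
Qed.

End Shuffle.

Arguments shuffle : simpl never.

Section LieSeries.
Variables (k : fieldType) (I : eqType).
Implicit Types (f : series k I) (u v w : seq I).

Lemma size_shuffle u v w : w \in shuffle u v -> size w = (size u + size v)%N.
Proof.
elim: u v w => [|x u IHu] v w; first by rewrite inE => /eqP ->.
elim: v w => [|y v IHv] w; first by rewrite shuffle_nilr inE addn0 => /eqP ->.
rewrite shuffle_cons mem_cat => /orP[] /mapP[w' w'in ->] /=.
  by rewrite (IHu _ _ w'in).
by rewrite (IHv _ w'in) addnS.
Qed.

Lemma lie_poly_primitive f : lie_poly f -> f [::] = 0 /\ primitive f.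
Proof.
elim=> {f} [c||f g _ [f0 F] _ [g0 G]|a f _ [f0 F]|f g _ [f0 F] _ [g0 G]].
- split=> // x u y v; rewrite big_seq big1 // => w /size_shuffle.
  by move=> sw; rewrite /letter; case: eqP sw => // -> /=; rewrite addnS.
- by split=> //; exact: primitive0.
- by split; [rewrite -[RHS]addr0 -{1}f0 -g0 | exact: primitiveD].
- by split; [rewrite -[RHS](mulr0 a) -f0 | exact: primitiveZ].
- split; last exact: primitive_bracket.
  by rewrite [LHS]/(smul f g [::] - smul g f [::]) !smul_nil f0 g0 mulr0; exact: subrr.
Qed.

Lemma lie_series_primitive f : lie_series f -> f [::] = 0 /\ primitive f.
Proof.
move=> F; split=> [|x u y v]; first by have [] := lie_poly_primitive (F 0%N).
have [_ /(_ x u y v) H] := lie_poly_primitive (F (size u + size v).+2).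
rewrite -[RHS]H big_seq [RHS]big_seq; apply: eq_bigr => w /size_shuffle.
by rewrite /homog => -> /=; rewrite addnS eqxx.
Qed.

End LieSeries.

(** * Quasi-shuffles and the harmonic coproduct *)

Section QuasiShuffle.
Implicit Types u v w z : seq nat.

(** The letter [p] stands for y_(p+1), so that y_(p+1) and y_(q+1) merge into the
    letter [(p + q).+1]. *)
Fixpoint qshuffle u : seq nat -> seq (seq nat) :=
  if u is p :: u' then
    fix qshuffle_u v :=
      if v is q :: v' then
        map (cons p) (qshuffle u' v) ++ map (cons q) (qshuffle_u v')
          ++ map (cons (p + q).+1) (qshuffle u' v')
      else [:: u]
  else fun v => [:: v].

Arguments qshuffle : simpl never.

Lemma qshuffle_nill v : qshuffle [::] v = [:: v]. Proof. by []. Qed.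

Lemma qshuffle_nilr u : qshuffle u [::] = [:: u].
Proof. by case: u. Qed.

Lemma qshuffle_cons p u q v : qshuffle (p :: u) (q :: v) =
  map (cons p) (qshuffle u (q :: v)) ++ map (cons q) (qshuffle (p :: u) v)
    ++ map (cons (p + q).+1) (qshuffle u v).
Proof. by []. Qed.

Definition qshuffleE := (qshuffle_nill, qshuffle_nilr, qshuffle_cons).

Lemma weight_cons p w : weight (p :: w) = (p.+1 + weight w)%N.
Proof. by []. Qed.

Lemma qshuffle_weight u v w : w \in qshuffle u v -> weight w = (weight u + weight v)%N.
Proof.
elim: u v w => [|p u IHu] v w; first by rewrite inE => /eqP ->.
elim: v w => [|q v IHv] w; first by rewrite qshuffle_nilr inE addn0 => /eqP ->.
rewrite qshuffle_cons !mem_cat => /or3P[] /mapP[w' w'in ->]; rewrite !weight_cons.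
- by rewrite (IHu _ _ w'in) weight_cons; lia.
- by rewrite (IHv _ w'in) weight_cons; lia.
- by rewrite (IHu _ _ w'in); lia.
Qed.

(** A merged letter is never 0: powers of y_1 only come from powers of y_1. *)
Lemma qshuffle_all0 u v w : w \in qshuffle u v ->
  all (pred1 0%N) w -> all (pred1 0%N) u && all (pred1 0%N) v.
Proof.
elim: u v w => [|p u IHu] v w; first by rewrite inE => /eqP ->.
elim: v w => [|q v IHv] w; first by rewrite qshuffle_nilr inE andbT => /eqP ->.
rewrite qshuffle_cons !mem_cat => /or3P[] /mapP[w' w'in ->] //= /andP[/eqP-> ].
- by move/(IHu _ _ w'in).
- by move/(IHv _ w'in) => /= /andP[-> ->].
Qed.

Section Sum.
Variable V : comNzRingType.
Implicit Types f g : seq nat -> V.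

Lemma sum_qshuffle_cons p u q v f :
  \sum_(w <- qshuffle (p :: u) (q :: v)) f w =
  \sum_(w <- qshuffle u (q :: v)) f (p :: w) +
  \sum_(w <- qshuffle (p :: u) v) f (q :: w) +
  \sum_(w <- qshuffle u v) f ((p + q).+1 :: w).
Proof. by rewrite qshuffle_cons !big_cat !big_map /= addrA. Qed.

Lemma eq_sum_qshuffle u v f g : (forall w, w != [::] -> f w = g w) -> u != [::] ->
  \sum_(w <- qshuffle u v) f w = \sum_(w <- qshuffle u v) g w.
Proof.
move=> fg u0; rewrite big_seq [RHS]big_seq; apply: eq_bigr => w /qshuffle_weight.
by case: w => [|? ?] E; rewrite fg //; case: u u0 E.
Qed.

(** Associativity, in weak form: summed against an arbitrary [f]. *)
Lemma qshuffleA u v z f :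
  \sum_(w <- qshuffle u v) \sum_(w' <- qshuffle w z) f w' =
  \sum_(w <- qshuffle v z) \sum_(w' <- qshuffle u w) f w'.
Proof.
elim: u v z f => [|p u IHu] v z f.
  by rewrite big_seq1; apply: eq_bigr => w _; rewrite big_seq1.
elim: v z f => [|q v IHv] z f.
  by rewrite qshuffle_nilr !big_seq1.
elim: z f => [|r z IHz] f.
  by rewrite qshuffle_nilr big_seq1; apply: eq_bigr => w _; rewrite qshuffle_nilr big_seq1.
rewrite sum_qshuffle_cons [RHS]sum_qshuffle_cons.
have rec_l (s : seq (seq nat)) h : \sum_(w <- s) \sum_(w' <- qshuffle (h :: w) (r :: z)) f w' =
    \sum_(w <- s) \sum_(w' <- qshuffle w (r :: z)) f (h :: w') +
    \sum_(w <- s) \sum_(w' <- qshuffle (h :: w) z) f (r :: w') +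
    \sum_(w <- s) \sum_(w' <- qshuffle w z) f ((h + r).+1 :: w').
  by rewrite -!big_split; apply: eq_bigr => w _; exact: sum_qshuffle_cons.
have rec_r (s : seq (seq nat)) h : \sum_(w <- s) \sum_(w' <- qshuffle (p :: u) (h :: w)) f w' =
    \sum_(w <- s) \sum_(w' <- qshuffle u (h :: w)) f (p :: w') +
    \sum_(w <- s) \sum_(w' <- qshuffle (p :: u) w) f (h :: w') +
    \sum_(w <- s) \sum_(w' <- qshuffle u w) f ((p + h).+1 :: w').
  by rewrite -!big_split; apply: eq_bigr => w _; exact: sum_qshuffle_cons.
(* The terms starting with [p], or with [r], recombine into a double sum to which
   the induction hypothesis on [u], or on [z], applies. *)
rewrite !rec_l !rec_r !IHu !IHv.
have := IHz (fun w => f (r :: w)); rewrite sum_qshuffle_cons => E.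
have := sum_qshuffle_cons q v r z
  (fun w => \sum_(w' <- qshuffle u w) f (p :: w')) => E'.
have -> : ((p + q).+1 + r = p + (q + r).+1)%N by lia.
rewrite {}E' -{}E; ring.
Qed.

End Sum.
End QuasiShuffle.

Arguments qshuffle : simpl never.

Section Coproduct.
Variable k : fieldType.
Implicit Types (f g S : series k nat) (T : tensor_square k) (u v w z : seq nat).

Lemma mul_letter_series (R : nzRingType) (I : eqType) (p : I) (F : series R I) (u : seq I) :
  (letter R p * F) u = if u is q :: u' then (q == p)%:R * F u' else 0.
Proof.
rewrite -[_ * F]/(smul (letter R p) F); case: u => [|q u].
  by rewrite smul_nil mul0r.
rewrite smul_cons mul0r add0r (_ : lquo q _ = (q == p)%:R); last first.
  apply/funext => w; rewrite /lquo /letter eqseq_cons.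
  by case: eqP => //= _; case: w.
rewrite -[smul _ _]/((q == p)%:R * F).
by case: eqP => _; rewrite ?mul1r ?mul0r.
Qed.

Lemma mul_tens1 g T u : (tens 1 g * T) u = g * T u.
Proof.
have -> : tens 1 g = (fun w => (nilp w)%:R *: g) :> tensor_square k by [].
rewrite -[_ * T]/(smul _ T); case: u => [|p u].
  by rewrite smul_nil scale1r.
rewrite smul_cons scale1r (_ : lquo p _ = 0); last first.
  by apply/funext => w; rewrite /lquo scale0r.
by rewrite -[smul 0 T]/(0 * T) mul0r addr0.
Qed.

Lemma mul_tens_letter p g T u : (tens (letter k p) g * T) u =
  if u is q :: u' then (q == p)%:R *: (g * T u') else 0.
Proof.
rewrite -[_ * T]/(smul _ T); case: u => [|q u].
  by rewrite smul_nil /tens scale0r mul0r.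
rewrite smul_cons /tens scale0r mul0r add0r.
case: (eqVneq q p) => [->|/negPf qp].
  rewrite (_ : lquo p _ = tens 1 g); last first.
    apply/funext => w; rewrite /lquo /tens /letter eqseq_cons eqxx /=.
    by case: w.
  by rewrite -[smul _ _]/(tens 1 g * T) mul_tens1 scale1r.
rewrite (_ : lquo q _ = 0) ?scale0r; last first.
  by apply/funext => w; rewrite /lquo /letter eqseq_cons qp scale0r.
by rewrite -[smul _ _]/(0 * T) mul0r.
Qed.

Lemma Delta_letterE m : Delta_letter k m = tens 1 (letter k m)
  + \sum_(j < m) tens (letter k (j : nat)) (letter k (m - j).-1) + tens (letter k m) 1.
Proof.
rewrite /Delta_letter big_ord_recl big_ord_recr /= ?subn0 ?subnn addrA.
congr (_ + _ + _); apply: eq_bigr => -[j jm] _ /=.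
by rewrite /bump /= add1n subSS; case: (m - j)%N (subn_gt0 j m) => //; rewrite jm.
Qed.

Lemma Delta_word_cons m w u v : Delta_word k (m :: w) u v =
  (if u is p :: u' then (p == m)%:R * Delta_word k w u' v else 0) +
  (if v is q :: v' then (q == m)%:R * Delta_word k w u v' else 0) +
  (if (u, v) is (p :: u', q :: v')
   then ((p + q).+1 == m)%:R * Delta_word k w u' v' else 0).
Proof.
rewrite {1}/Delta_word big_cons -/(Delta_word k w) Delta_letterE.
set T := Delta_word k w; rewrite !mulrDl mulr_suml.
have ev (A B : tensor_square k) : (A + B) u v = A u v + B u v by [].
have evs (F : 'I_m -> tensor_square k) :
    (\sum_(j < m) F j) u v = \sum_(j < m) F j u v.
  by elim/big_rec2: _ => // j a b _ <-.
rewrite !ev evs mul_tens1 mul_tens_letter mul_letter_series {ev evs}.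
under eq_bigr do rewrite mul_tens_letter.
rewrite addrC addrA; congr (_ + _ + _).
  by case: u => // p u; rewrite mul1r.
case: u => [|p u]; first by rewrite big1.
have evZ a (f : series k nat) z : (a *: f) z = a * f z by [].
under eq_bigr do rewrite evZ mul_letter_series.
case: v => [|q v]; first by rewrite big1 // => j _; rewrite mulr0.
case: (ltnP p m) => pm; last first.
  have /negPf-> : ((p + q).+1 != m)%N by apply/eqP; lia.
  rewrite mul0r big1 // => -[j jm] _ /=.
  have /negPf-> : (p != j)%N by apply/eqP; lia.
  by rewrite mul0r.
rewrite (bigD1 (Ordinal pm)) //= eqxx mul1r big1 ?addr0.
  congr (_%:R * _); congr (nat_of_bool _); apply/eqP/eqP; lia.
move=> j; rewrite -val_eqE /= => /negPf; rewrite eq_sym => ->.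
by rewrite mul0r.
Qed.

(** The coefficient of u (x) v in Delta_*(w) is the multiplicity of w in the
    quasi-shuffle of u and v. *)
Lemma Delta_word_qshuffle w u v :
  Delta_word k w u v = \sum_(z <- qshuffle u v) (z == w)%:R.
Proof.
elim: w u v => [|m w IH] u v.
  rewrite /Delta_word big_nil.
  have -> : (1 : tensor_square k) u v = (nilp u)%:R * (nilp v)%:R.
    by case: u => [|p u]; rewrite ?mul1r ?mul0r.
  case: u v => [|p u] [|q v]; rewrite ?mul0r ?mul1r ?qshuffleE ?big_seq1 //.
  by rewrite !big_cat !big_map /= !big1 // !addr0.
rewrite Delta_word_cons; have e p z : (p :: z == m :: w)%:R =
    (p == m)%:R * (z == w)%:R :> k.
  by rewrite eqseq_cons; case: (p == m); rewrite ?mul1r ?mul0r.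
case: u v => [|p u] [|q v]; rewrite ?qshuffleE ?big_seq1 ?e ?IH ?qshuffleE ?big_seq1;
  rewrite ?add0r ?addr0 //.
rewrite !big_cat !big_map /= !mulr_sumr addrA.
by congr (_ + _ + _); apply: eq_bigr => z _; rewrite e.
Qed.

Lemma mem_weight p w : p \in w -> (p < weight w)%N.
Proof.
elim: w => // q w IH; rewrite inE weight_cons => /orP[/eqP ->|/IH]; lia.
Qed.

Lemma size_weight w : (size w <= weight w)%N.
Proof. by elim: w => // q w IH; rewrite weight_cons /=; lia. Qed.

(** The double sum in [Delta_star] runs over enough words: a word of weight N has
    at most N letters, all less than N. *)
Lemma sum_words N z (c : k) : weight z = N ->
  \sum_(n < N.+1) \sum_(t : n.-tuple 'I_N)
    c * (z == [seq nat_of_ord i | i <- t])%:R = c.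
Proof.
move=> zN; have sz : (size z < N.+1)%N by rewrite ltnS -zN size_weight.
have zlt p : p \in z -> (p < N)%N by rewrite -zN; exact: mem_weight.
rewrite (bigD1 (Ordinal sz)) //= [X in _ + X]big1 ?addr0; last first.
  move=> n; rewrite -val_eqE /= => nz; rewrite big1 // => t _.
  case: eqP => [E|]; rewrite ?mulr0 //; move: nz.
  by rewrite E size_map size_tuple eqxx.
pose t0 := pmap insub z : seq 'I_N.
have t0E : [seq nat_of_ord i | i <- t0] = z.
  rewrite /t0 -[RHS]map_id; elim: z zlt {zN sz t0} => //= p z IH H.
  by rewrite insubT ?H ?inE ?eqxx //= => H'; rewrite IH // => q qz; rewrite H ?inE ?qz ?orbT.
have t0s : size t0 == size z by rewrite -t0E size_map.
rewrite (bigD1 (Tuple t0s)) //= t0E eqxx mulr1 big1 ?addr0 // => t.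
move=> tt0; case: eqP => [E|_]; last exact: mulr0.
case/eqP: tt0; apply/val_inj/(inj_map val_inj); by rewrite /= t0E.
Qed.

Lemma Delta_starE S u v : Delta_star S u v = \sum_(w <- qshuffle u v) S w.
Proof.
rewrite /Delta_star; set N := (_ + _)%N.
under eq_bigr => n _ do under eq_bigr => t _ do
  rewrite Delta_word_qshuffle mulr_sumr.
under eq_bigr => n _ do rewrite exchange_big.
rewrite exchange_big [LHS]big_seq [RHS]big_seq; apply: eq_bigr => z zin.
rewrite -[RHS](sum_words (S z) (qshuffle_weight zin)).
apply: eq_bigr => n _; apply: eq_bigr => t _.
by case: eqP => [<-|_]; rewrite ?mulr0.
Qed.

Lemma Delta_star_primitive S : S [::] = 0 ->
  Delta_star S = tens 1 S + tens S 1 <->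
  forall p u q v, \sum_(w <- qshuffle (p :: u) (q :: v)) S w = 0.
Proof.
move=> S0.
have ev u v : (tens 1 S + tens S 1) u v = (nilp u)%:R * S v + S u * (nilp v)%:R by [].
split=> [E p u q v|E].
  by rewrite -Delta_starE E ev /= mul0r mulr0 addr0.
apply/funext => u; apply/funext => v; rewrite ev Delta_starE.
case: u v => [|p u] [|q v]; rewrite /= ?qshuffleE ?big_seq1 ?E;
  by rewrite ?S0 ?mul1r ?mulr1 ?mulr0 ?mul0r ?addr0 ?add0r.
Qed.

End Coproduct.

(** * Quasi-shuffle relations between powers of y_1 *)

Notation all0 := (all (pred1 0%N)).

Section Zeros.
Variable k : fieldType.
Implicit Types (S : series k nat) (f : seq nat -> k) (u v w : seq nat).

Definition sum_insert (m n : nat) f : k :=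
  \sum_(j < n.+1) f (nseq j 0%N ++ m :: nseq (n - j) 0%N).

Lemma sum_insert_rec m n f : sum_insert m n f = f (m :: nseq n 0%N)
  + (if n is n'.+1 then sum_insert m n' (fun w => f (0%N :: w)) else 0).
Proof.
rewrite /sum_insert; case: n => [|n]; first by rewrite big_ord1 addr0.
by rewrite big_ord_recl subn0; congr (_ + _).
Qed.

Lemma sum_insert0 n f : sum_insert 0 n f = n.+1%:R * f (nseq n.+1 0%N).
Proof.
rewrite /sum_insert (eq_bigr (fun=> f (nseq n.+1 0%N))) => [|[j jn] _ /=].
  by rewrite sumr_const card_ord mulr_natl.
have E : (j + (n - j).+1 = n.+1)%N by lia.
by rewrite -[X in _ ++ X]/(nseq (n - j).+1 0%N) -nseqD E.
Qed.

Lemma sum_qshuffle_zeros m n f :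
  \sum_(w <- qshuffle [:: m] (nseq n 0%N)) f w =
  sum_insert m n f + (if n is n'.+1 then sum_insert m.+1 n' f else 0).
Proof.
elim: n f => [|n IH] f.
  by rewrite qshuffle_nilr big_seq1 sum_insert_rec !addr0.
rewrite [nseq n.+1 _]/= sum_qshuffle_cons !big_seq1 IH addn0.
by rewrite [sum_insert m n.+1 f]sum_insert_rec [sum_insert m.+1 n f]sum_insert_rec; ring.
Qed.

(** Write I(m,n) for [sum_insert m n S]. The relation between [m.+1] and the n-th
    power of y_1 reads I(m.+1,n) = - I(m.+2,n-1), so that I(1,n) is S(y_(n+2)) up
    to sign. Hence the hypothesis on powers of y_1 is the relation between y_1
    and a power of y_1. The other powers follow by induction, since y_1 y_1^n,
    for the quasi-shuffle product, is n+1 times y_1^(n+1) plus words that are not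
    powers of y_1. *)
Lemma all_qshuffle_relations S : [pchar k] =i pred0 ->
    (forall n, n.+2%:R * S (nseq n.+2 0%N) + (-1) ^+ n * S [:: n.+1] = 0) ->
    (forall u v, u != [::] -> v != [::] -> ~~ (all0 u && all0 v) ->
       \sum_(w <- qshuffle u v) S w = 0) ->
  forall u v, u != [::] -> v != [::] -> \sum_(w <- qshuffle u v) S w = 0.
Proof.
move=> /pcharf0P char0 S0 H.
have one_letter n m : sum_insert m.+1 n S = (-1) ^+ n * S [:: (m + n).+1].
  elim: n m => [|n IH] m; first by rewrite sum_insert_rec addr0 mul1r addn0.
  have := H [:: m.+1] (nseq n.+1 0%N) isT isT isT.
  rewrite sum_qshuffle_zeros IH addSnnS => /eqP; rewrite addr_eq0 => /eqP ->.
  by rewrite exprS mulN1r mulNr.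
have y1 v : v != [::] -> \sum_(w <- qshuffle [:: 0%N] v) S w = 0.
  move=> v0; case: (boolP (all0 v)) => [|v1]; last by rewrite H.
  move=> /all_pred1P vE; move: v0; rewrite {}vE.
  case: (size v) => // n _; rewrite sum_qshuffle_zeros sum_insert0 one_letter.
  exact: S0.
move=> u v u0 v0; case: (boolP (all0 u)) => [|u1]; last by rewrite H // (negPf u1).
move=> /all_pred1P uE; move: u0; rewrite {}uE; case: (size u) => // n _.
elim: n => [|n IH]; first exact: y1.
pose f u' := \sum_(w <- qshuffle u' v) S w.
have : \sum_(w <- qshuffle [:: 0%N] (nseq n.+1 0%N)) f w = 0.
  rewrite /f qshuffleA (@eq_sum_qshuffle _ _ _ _ (fun=> 0)) //.
  by rewrite big1.
rewrite sum_qshuffle_zeros sum_insert0 [sum_insert 1 n f]big1 ?addr0.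
  by move=> /eqP; rewrite mulf_eq0 char0 => /eqP.
move=> j _; apply: H => //; first by case: (nat_of_ord j).
by rewrite all_cat /= andbF.
Qed.

End Zeros.

(** * Quasi-shuffles sorted by the origin of their first letters *)

Section SplitSums.
Variable k : comNzRingType.
Implicit Types (a b c d w : seq nat) (K : seq nat -> seq nat -> k).

(** The quasi-shuffles whose first letter comes from [b], possibly merged: in
    terms of summation variables, the largest one belongs to [b]. *)
Definition qshuffle_headr a b : seq (seq nat) :=
  if b is n :: b' then
    if a is m :: a' then
      map (cons n) (qshuffle a b') ++ map (cons (m + n).+1) (qshuffle a' b')
    else [:: b]
  else if a is [::] then [:: [::]] else [::].

Lemma sum_qshuffle_headr m a b (f : seq nat -> k) :
  \sum_(w <- qshuffle (m :: a) b) f w =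
  \sum_(w <- qshuffle a b) f (m :: w) + \sum_(w <- qshuffle_headr (m :: a) b) f w.
Proof.
case: b => [|n b]; first by rewrite !qshuffle_nilr !big_seq1 big_nil addr0.
by rewrite sum_qshuffle_cons big_cat !big_map /= addrA.
Qed.

Lemma sum_qshuffle_headr_cons m a n b (f : seq nat -> k) :
  \sum_(w <- qshuffle_headr (m :: a) (n :: b)) f w =
  \sum_(w <- qshuffle (m :: a) b) f (n :: w) +
  \sum_(w <- qshuffle a b) f ((m + n).+1 :: w).
Proof. by rewrite big_cat !big_map. Qed.

Lemma mem_qshuffle_headr a b w : w \in qshuffle_headr a b -> w \in qshuffle a b.
Proof.
case: a b => [|m a] [|n b] //.
by rewrite qshuffle_cons !mem_cat => /orP[] ->; rewrite ?orbT.
Qed.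

(** In a quasi-shuffle of [a] and [b], the letters that precede every letter of
    [b] form a prefix of [a]. This sum runs over such prefixes, which are appended
    to [d], and over the quasi-shuffles [c] of the remaining letters. For [d]
    empty and [K c e] standing for l^{y,x}_{c,e}, the terms with [e] nonempty are
    those of Li_a(x) Li_b(y) in which x carries the largest variable alone. *)
Fixpoint sum_split K d a b : k :=
  \sum_(c <- qshuffle_headr a b) K c d +
  (if a is m :: a' then sum_split K (rcons d m) a' b else 0).

Lemma sum_split_nil K d b :
  sum_split K d [::] b = K b d.
Proof. by case: b => [|n b]; rewrite /= big_seq1 addr0. Qed.

Lemma sum_split_cons K d m a b : sum_split K d (m :: a) b =
  \sum_(c <- qshuffle_headr (m :: a) b) K c d + sum_split K (rcons d m) a b.
Proof. by []. Qed.

Definition sum_splitE := (sum_split_nil, sum_split_cons).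

Lemma sum_splitD K1 K2 d a b :
  sum_split (fun c e => K1 c e + K2 c e) d a b =
  sum_split K1 d a b + sum_split K2 d a b.
Proof.
elim: a d => [|m a IH] d; rewrite !sum_splitE // big_split /= IH; ring.
Qed.

(** When [K] only depends on the concatenation, all the quasi-shuffles are
    recovered, each one once. *)
Lemma sum_split_cat (g : seq nat -> k) d a b :
  sum_split (fun c e => g (e ++ c)) d a b = \sum_(w <- qshuffle a b) g (d ++ w).
Proof.
elim: a d => [|m a IH] d; rewrite sum_splitE.
  by rewrite big_seq1.
rewrite IH sum_qshuffle_headr addrC; congr (_ + _).
by apply: eq_bigr => w _; rewrite cat_rcons.
Qed.

Lemma sum_split_nilr K d a : sum_split K d a [::] = K [::] (d ++ a).
Proof.
elim: a d => [|m a IH] d; rewrite sum_splitE; first by rewrite cats0.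
by rewrite IH big_nil add0r cat_rcons.
Qed.

End SplitSums.

Definition word_of (w : seq nat) : seq bool := flatten [seq xblock m | m <- w].

Lemma word_of_0 w : word_of (0%N :: w) = x1 :: word_of w. Proof. by []. Qed.

Lemma word_of_S n w : word_of (n.+1 :: w) = x0 :: word_of (n :: w). Proof. by []. Qed.

Arguments word_of : simpl never.

(** * The quasi-shuffle product formula for functionals on two letters *)

Section Recursion.
Variable k : fieldType.
Implicit Types (f : series k bool) (a b c d u v w : seq nat).

Lemma pi_Y_nil f : pi_Y f [::] = f [::].
Proof. exact: mul1r. Qed.

Lemma pi_Y_S f n w : pi_Y f (n.+1 :: w) = pi_Y (lquo x0 f) (n :: w).
Proof. by []. Qed.

Lemma pi_Y_0 f w : pi_Y f (0%N :: w) = - pi_Y (lquo x1 f) w.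
Proof. by rewrite /pi_Y /= exprS mulN1r mulNr. Qed.

(** The hypotheses on [G] are the recursion for l^{y,x} when (omega45, omega12,
    omega34, omega23, omega24) take the values (1,0), (0,0), (0,1), (0,1), (0,1)
    on (x_0, x_1), as they do on the two letters of psi_451. *)
Variable G : seq nat -> seq nat -> series k bool -> k.
Hypothesis G_nilr : forall u f, G u [::] f = pi_Y f u.
Hypothesis G_nill : forall n v f, G [::] (n :: v) f =
  if n is 0 then - G [::] v (lquo x1 f) else 0.
Hypothesis G_cons : forall m u n v f, G (m :: u) (n :: v) f =
  (if m is m'.+1 then G (m' :: u) (n :: v) (lquo x0 f) else
     - G u (n :: v) (lquo x1 f)
     - (G (last n v :: u) (belast n v) (lquo x0 f)
        - G (last n v :: u) (belast n v) (lquo x1 f)))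
  + (if n is 0 then - G (m :: u) v (lquo x1 f) else 0).

Definition split_G d a b f : k := sum_split (fun c e => G c e f) d a b.

Definition sum_G_cons q d a b f : k := \sum_(c <- qshuffle a b) G (q :: c) d f.

Lemma split_G_S p d a n b f : split_G (p :: d) a (n.+1 :: b) f =
  split_G (p :: d) a (n :: b) (lquo x0 f)
  + (if p is 0 then - split_G d a (n.+1 :: b) (lquo x1 f) else 0).
Proof.
have Gc c : G (n.+1 :: c) (p :: d) f = G (n :: c) (p :: d) (lquo x0 f)
    + (if p is 0 then - G (n.+1 :: c) d (lquo x1 f) else 0) by rewrite G_cons.
rewrite /split_G; elim: a d {Gc} => [|m a IH] d; rewrite !sum_splitE.
  by rewrite G_cons; case: p => [|p]; ring.
rewrite !sum_qshuffle_headr_cons rcons_cons IH addnS.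
under eq_bigr do rewrite G_cons; rewrite big_split /=.
under [X in _ + _ + X + _ = _]eq_bigr do rewrite G_cons; rewrite big_split /=.
by case: p {IH} => [|p]; rewrite ?sumrN ?big1_eq ?sum_qshuffle_headr_cons ?addnS; ring.
Qed.

(** The recursion moves the last letter of the second argument of [G] to the
    front of the first one, which gives a term [sum_G_cons]; a first letter [0]
    of [b] merged with a letter of [a] gives another such term. As the cut moves
    along [a], they cancel in pairs, except for the first one. *)
Lemma split_G_0 p d q d' a b f : p :: d = rcons d' q ->
  split_G (p :: d) a (0%N :: b) f =
  - split_G (p :: d) a b (lquo x1 f)
  + (sum_G_cons q d' a b (lquo x1 f) - sum_G_cons q d' a b (lquo x0 f))
  + (if p is 0 then - split_G d a (0%N :: b) (lquo x1 f) else 0).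
Proof.
move=> E; have Gc c e q' e' : p :: e = rcons e' q' -> G (0%N :: c) (p :: e) f =
    - G c (p :: e) (lquo x1 f)
    + (G (q' :: c) e' (lquo x1 f) - G (q' :: c) e' (lquo x0 f))
    + (if p is 0 then - G (0%N :: c) e (lquo x1 f) else 0).
  by rewrite G_cons lastI => /rcons_inj[-> ->]; ring.
rewrite /split_G /sum_G_cons; elim: a d q d' E => [|m a IH] d q d' E.
  by rewrite !sum_splitE qshuffle_nill !big_seq1 (Gc _ _ _ _ E).
rewrite !sum_split_cons !sum_qshuffle_headr_cons rcons_cons (IH _ m (p :: d)) // addn0.
under eq_bigr => c _ do rewrite (Gc _ _ _ _ E).
under [X in _ + X + _ = _]eq_bigr do rewrite G_cons.
rewrite !big_split !sumrN /= sum_qshuffle_headr; case: p {IH Gc E} => [|p];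
  rewrite ?sumrN ?big1_eq; ring.
Qed.

Lemma pi_Y_split m a b f : \sum_(w <- qshuffle (m :: a) b) pi_Y f w =
  \sum_(w <- qshuffle_headr (m :: a) b) G w [::] f + sum_G_cons m [::] a b f.
Proof.
rewrite sum_qshuffle_headr addrC.
by congr (_ + _); apply: eq_bigr => w _; rewrite G_nilr.
Qed.

Lemma split_G_nil_S m a n b f : split_G [::] (m :: a) (n.+1 :: b) f =
  split_G [::] (m :: a) (n :: b) (lquo x0 f)
  + (if m is 0 then - split_G [::] a (n.+1 :: b) (lquo x1 f) else 0).
Proof.
rewrite {1 2}/split_G !sum_split_cons -![sum_split _ (rcons _ _) _ _]/(split_G _ _ _ _).
rewrite split_G_S !sum_qshuffle_headr_cons addnS.
under eq_bigr do rewrite G_nilr pi_Y_S -G_nilr.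
by under [X in _ + X + _ = _]eq_bigr do rewrite G_nilr pi_Y_S -G_nilr; ring.
Qed.

(** For [d] empty, the last term left by the cancellation in [split_G_0] cancels
    too, against those of the coefficients [G w [::]]: what remains, here and in
    [split_G_nil_S], is the recursion of a shuffle product. *)
Lemma split_G_nil_0 m a b f : split_G [::] (m :: a) (0%N :: b) f =
  - split_G [::] (m :: a) b (lquo x1 f)
  + (if m is 0 then - split_G [::] a (0%N :: b) (lquo x1 f) else 0).
Proof.
rewrite {1 2}/split_G !sum_split_cons -![sum_split _ (rcons _ _) _ _]/(split_G _ _ _ _).
rewrite (@split_G_0 m [::] m [::]) // !sum_qshuffle_headr_cons addn0.
under eq_bigr do rewrite G_nilr pi_Y_0.
under [X in _ + X + _ = _]eq_bigr do rewrite G_nilr pi_Y_S -(G_nilr (m :: _)).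
rewrite sumrN pi_Y_split /sum_G_cons; ring.
Qed.

(** The product formula: on these two letters, Li_a(x) becomes
    (-1)^k times the word x_1^k if [a] consists of k zeros, and 0 otherwise. *)
Lemma split_G_shuffle a b f : split_G [::] a b f =
  (all0 a)%:R * (-1) ^+ (size a + size b)
    * \sum_(w <- shuffle (nseq (size a) x1) (word_of b)) f w.
Proof.
elim: a b f => [|m a IHa] b f.
  by rewrite /split_G sum_splitE big_seq1 G_nilr mul1r.
elim: b f => [|n b IHb] f.
  rewrite /split_G sum_split_nilr cat0s shuffle_nilr big_seq1 G_nill.
  case: m => [|m] /=; last by rewrite !mul0r.
  have := IHa [::] (lquo x1 f); rewrite /split_G sum_split_nilr => ->.
  by rewrite shuffle_nilr big_seq1 !addn0 exprS /lquo; ring.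
elim: n f => [|n IHn] f.
  rewrite split_G_nil_0 IHb IHa; case: m {IHb} => [|m] /=; last by rewrite !mul0r oppr0 addr0.
  rewrite word_of_0 sum_shuffle_cons !(addnS, addSn, exprS) /lquo; ring.
rewrite split_G_nil_S IHn; case: m {IHn IHb} => [|m] /=; last by rewrite !mul0r addr0.
rewrite IHa word_of_S sum_shuffle_cons !(addnS, addSn, exprS) /lquo; ring.
Qed.

Lemma split_G_primitive m a n b f : f [::] = 0 -> primitive f ->
  split_G [::] (m :: a) (n :: b) f = 0.
Proof.
move=> f0 F; rewrite split_G_shuffle.
by case: n => [|n]; rewrite /= F mulr0.
Qed.

End Recursion.

(** * Polylogarithmic functionals on a series in two of the x_ij *)

Section Pullback.
Variables (k : fieldType) (c d : gen5).
Implicit Types (f : series k bool) (u v : seq nat) (p q : Defs.form k) (l : series k gen5 -> k).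

Definition letter_image (b : bool) : gen5 := if b then d else c.

Lemma prod_letters (s : seq bool) (w : seq gen5) :
  (\prod_(b <- s) (if b then letter k d else letter k c)) w =
  (w == map letter_image s)%:R.
Proof.
elim: s w => [|b s IH] w; first by rewrite big_nil; case: w.
rewrite big_cons -(fun_if (fun x => letter k x)) -/(letter_image b) mul_letter_series.
case: w => [|e w] //=; rewrite IH eqseq_cons.
by case: (e == _); rewrite ?mul1r ?mul0r.
Qed.

Lemma sum_tuple_cons n (F : n.+1.-tuple bool -> k) :
  \sum_t F t = \sum_(t : n.-tuple bool) F [tuple of x0 :: t]
             + \sum_(t : n.-tuple bool) F [tuple of x1 :: t].
Proof.
rewrite (reindex (fun p : bool * n.-tuple bool => [tuple of p.1 :: p.2])) /=.
  rewrite -(pair_bigA _ (fun (b : bool) (t : n.-tuple bool) => F [tuple of b :: t])) /=.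
  by rewrite big_bool addrC.
exists (fun t => (thead t, behead_tuple t)) => [[b t] _|t _] /=.
  by congr pair; apply/val_inj.
by rewrite [RHS]tuple_eta; apply/val_inj.
Qed.

Definition pullback f : series k gen5 := subst (letter k c) (letter k d) f.

Lemma pullbackE f w : pullback f w =
  \sum_(t : (size w).-tuple bool) f t * (w == map letter_image t)%:R.
Proof.
rewrite /pullback /subst big_ord_recr /= big1 ?add0r => [|n _].
  by apply: eq_bigr => t _; rewrite prod_letters.
rewrite big1 // => t _; rewrite prod_letters.
case: eqP => [E|_]; last exact: mulr0.
have := ltn_ord n; rewrite -[X in (X < _)%N](size_tuple t).
by rewrite -(size_map letter_image) -E ltnn.
Qed.

Lemma pullback_nil f : pullback f [::] = f [::].
Proof.
rewrite pullbackE (bigD1 [tuple]) //= mulr1 big1 ?addr0 // => t.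
by rewrite tuple0 => /eqP.
Qed.

Lemma lquo_pullback (e : gen5) f : lquo e (pullback f) =
  (e == c)%:R *: pullback (lquo x0 f) + (e == d)%:R *: pullback (lquo x1 f).
Proof.
apply/funext => w; rewrite /lquo pullbackE sum_tuple_cons.
rewrite [RHS]/((e == c)%:R * pullback (lquo x0 f) w +
  (e == d)%:R * pullback (lquo x1 f) w) !pullbackE !mulr_sumr.
by congr (_ + _); apply: eq_bigr => t _; rewrite eqseq_cons -mulnb natrM mulrCA.
Qed.

(** What [bar p] becomes after restriction to the two letters [c] and [d]. *)
Definition bar_pb p (F : series k bool -> k) f : k :=
  p c * F (lquo x0 f) + p d * F (lquo x1 f).

Lemma bar_pullback p l f : linear_fun l ->
  bar p l (pullback f) = bar_pb p (fun f => l (pullback f)) f.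
Proof.
move=> lin; rewrite /bar.
have pick (e : gen5) (x : k) : \sum_(e' : gen5) p e' * ((e' == e)%:R * x) = p e * x.
  rewrite (bigD1 e) //= eqxx mul1r big1 ?addr0 // => e' /negPf ->.
  by rewrite mul0r mulr0.
under eq_bigr do rewrite lquo_pullback linD // -[_ *: _]addr0 lin lin0 //
   -[X in _ + l X]addr0 lin lin0 // !addr0 mulrDr.
by rewrite big_split /= !pick.
Qed.

(** The recursion of the functionals acts on the last entry of an index, hence on
    the head of its code. *)
Definition index_of u : seq nat := rev (map succn u).

Lemma positive_index_of u : positive (index_of u).
Proof. by rewrite /positive all_rev all_map; apply/allP. Qed.

Lemma index_of_cons m u : index_of (m :: u) = rcons (index_of u) m.+1.
Proof. exact: rev_cons. Qed.

(** The entry that [polylogX] moves from the second index to the first one is the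
    last letter of the code. *)
Lemma index_of_belast n v :
  index_of (n :: v) = (last n v).+1 :: index_of (belast n v).
Proof. by rewrite /index_of lastI map_rcons rev_rcons. Qed.

Definition polylog1_pb p q u f : k := polylog1 p q (index_of u) (pullback f).

Lemma polylog1_pb_nil p q f : polylog1_pb p q [::] f = f [::].
Proof. by rewrite /polylog1_pb polylog1_nil /eps pullback_nil. Qed.

Lemma polylog1_pb_cons p q n u f : polylog1_pb p q (n :: u) f =
  if n is n'.+1 then bar_pb p (polylog1_pb p q (n' :: u)) f
  else - bar_pb q (polylog1_pb p q u) f.
Proof.
rewrite /polylog1_pb index_of_cons; case: n => [|n].
  by rewrite polylog1_rcons1 fnlN bar_pullback //; exact: lin_polylog1.
by rewrite polylog1_rcons bar_pullback ?index_of_cons //; exact: lin_polylog1.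
Qed.

Variables w12 w45 w23 w34 w24 : Defs.form k.

Definition polylog2_pb u v f : k :=
  polylog2 w12 w45 w23 w34 w24 (index_of u) (index_of v) (pullback f).

Lemma polylog2_pb_nill v f : polylog2_pb [::] v f = polylog1_pb w45 w34 v f.
Proof. by rewrite /polylog2_pb polylog2_nil. Qed.

Lemma polylog2_pb_nilr u f : polylog2_pb u [::] f = polylog1_pb (w12 + w45) w24 u f.
Proof. by rewrite /polylog2_pb polylog2_nilr. Qed.

Lemma polylog2_pb_cons m u n v f : polylog2_pb (m :: u) (n :: v) f =
  (if m is m'.+1 then bar_pb w12 (polylog2_pb (m' :: u) (n :: v)) f else
     - bar_pb w23 (polylog2_pb u (n :: v)) f
     - bar_pb (w12 - w23) (polylog2_pb (last n v :: u) (belast n v)) f)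
  + (if n is n'.+1 then bar_pb w45 (polylog2_pb (m :: u) (n' :: v)) f
     else - bar_pb w34 (polylog2_pb (m :: u) v) f).
Proof.
have lin a b := lin_polylog2 w12 w45 w23 w34 w24 a b.
rewrite /polylog2_pb !index_of_cons polylog2_rcons ?positive_index_of // -index_of_cons.
rewrite index_of_belast /= -!index_of_cons -[LHS]/(_ (pullback f) + _ (pullback f)).
congr (_ + _).
  case: m => [|m]; last by rewrite bar_pullback -?index_of_cons.
  by rewrite -[LHS]/(- bar _ _ _ - bar _ _ _) !bar_pullback.
case: n => [|n]; last by rewrite bar_pullback -?index_of_cons.
by rewrite fnlN bar_pullback.
Qed.

End Pullback.

Arguments polylog1_pb : simpl never.
Arguments polylog2_pb : simpl never.

(** * The five terms of the pentagon defect *)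

Lemma weight_ind2 (P : seq nat -> seq nat -> Prop) :
  (forall u v, (forall u' v', (weight u' + weight v' < weight u + weight v)%N ->
     P u' v') -> P u v) -> forall u v, P u v.
Proof.
move=> H u v; have [n] := ubnP (weight u + weight v)%N.
elim: n u v => // n IH u v uv; apply: H => u' v' lt; apply: IH; lia.
Qed.

Lemma weight_rcons w p : weight (rcons w p) = (weight w + p.+1)%N.
Proof. by rewrite /weight map_rcons sumn_rcons. Qed.

Lemma weight_belast n v :
  (weight (belast n v) + (last n v).+1 = weight (n :: v))%N.
Proof. by rewrite lastI weight_rcons. Qed.

(** In the next lemmas the forms (w12, w45, w23, w34, w24) are to be replaced by
    (omega45, omega12, omega34, omega23, omega24), as in [l_yx]; the suffix 543
    refers to the values of these on the letters x_54 and x_43 of psi_543, and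
    likewise for the other ones. *)

Section Evaluation.
Variables (k : fieldType) (c d : gen5).
Variables w12 w45 w23 w34 w24 : Defs.form k.
Implicit Types (f : series k bool) (u v : seq nat) (p q : Defs.form k).

Local Notation polylog1_pb := (polylog1_pb c d).
Local Notation polylog2_pb := (polylog2_pb c d w12 w45 w23 w34 w24).
Local Notation restr := (fun p : Defs.form k => (p c, p d)).

Lemma bar_pb_const p : restr p = (0, 0) -> forall F f, bar_pb c d p F f = 0.
Proof. by case=> pc pd F f; rewrite /bar_pb pc pd !mul0r addr0. Qed.

Lemma bar_pb_x0 p : restr p = (1, 0) ->
  forall F f, bar_pb c d p F f = F (lquo x0 f).
Proof. by case=> pc pd F f; rewrite /bar_pb pc pd mul0r mul1r addr0. Qed.

Lemma bar_pb_x1 p : restr p = (0, 1) ->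
  forall F f, bar_pb c d p F f = F (lquo x1 f).
Proof. by case=> pc pd F f; rewrite /bar_pb pc pd mul0r mul1r add0r. Qed.

Lemma restrB p q x y x' y' : restr p = (x, y) -> restr q = (x', y') ->
  restr (p - q) = (x - x', y - y').
Proof. by case=> <- <- [<- <-]. Qed.

Lemma restrD p q x y x' y' : restr p = (x, y) -> restr q = (x', y') ->
  restr (p + q) = (x + x', y + y').
Proof. by case=> <- <- [<- <-]. Qed.

Lemma polylog1_pb_pi_Y p q u f : restr p = (1, 0) -> restr q = (0, 1) ->
  polylog1_pb p q u f = pi_Y f u.
Proof.
move=> rp rq; elim: u f => [|n u IH] f; first by rewrite polylog1_pb_nil pi_Y_nil.
elim: n f => [|n IHn] f; rewrite polylog1_pb_cons.
  by rewrite (bar_pb_x1 rq) IH pi_Y_0.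
by rewrite (bar_pb_x0 rp) IHn pi_Y_S.
Qed.

Lemma polylog1_pb_eq0 p q u f : restr q = (0, 0) -> u != [::] -> polylog1_pb p q u f = 0.
Proof.
move=> rq; case: u => // n u _; elim: n f => [|n IH] f; rewrite polylog1_pb_cons.
  by rewrite (bar_pb_const rq) oppr0.
by rewrite /bar_pb !IH !mulr0 addr0.
Qed.

Lemma polylog1_pb_all0 p q u f : restr p = (0, 0) -> ~~ all0 u -> polylog1_pb p q u f = 0.
Proof.
move=> rp; elim: u f => // n u IH f; rewrite polylog1_pb_cons; case: n => [|n] /= u0.
  by rewrite /bar_pb !IH // !mulr0 addr0 oppr0.
by rewrite (bar_pb_const rp).
Qed.

(** Only the steps on the first index survive, and the nonempty index that is left
    when they stop involves the form [w34] or [w24], which vanishes. *)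
Lemma polylog2_pb_543 u v f : restr w45 = (0, 0) -> restr w34 = (0, 0) ->
  restr w24 = (0, 0) -> ~~ nilp (u ++ v) -> polylog2_pb u v f = 0.
Proof.
move=> r45 r34 r24; move: u v f; apply: weight_ind2 => u v IH f.
case: u v IH => [|m u] [|n v] // IH _.
- by rewrite polylog2_pb_nill polylog1_pb_eq0.
- by rewrite polylog2_pb_nilr polylog1_pb_eq0.
have pf0 w u' v' : (weight u' + weight v' < weight (m :: u) + weight (n :: v))%N ->
    ~~ nilp (u' ++ v') -> bar_pb c d w (polylog2_pb u' v') f = 0.
  by move=> lt nn; rewrite /bar_pb !IH // !mulr0 addr0.
have wb := weight_belast n v; rewrite polylog2_pb_cons.
rewrite (_ : (if n is n'.+1 then _ else _) = 0) ?addr0; last first.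
  by case: (n) => [|n'] /=; rewrite ?(bar_pb_const r45) ?(bar_pb_const r34) ?oppr0.
case: m pf0 {IH} => [|m] /= pf0; last by rewrite pf0 // !weight_cons; lia.
rewrite !pf0 ?oppr0 ?addr0 //; move: wb; rewrite !weight_cons; try lia.
by case: (u).
Qed.

(** Only the steps on the second index survive; once it is used up, the functional
    of the first index is left, and it involves [w24], which vanishes. *)
Lemma polylog2_pb_123 u v f : restr w12 = (0, 0) -> restr w23 = (0, 0) ->
  restr w24 = (0, 0) -> u != [::] -> polylog2_pb u v f = 0.
Proof.
move=> r12 r23 r24; case: u => // m u _.
have rB := restrB r12 r23; rewrite subr0 in rB.
elim: v f => [|n v IH] f; first by rewrite polylog2_pb_nilr polylog1_pb_eq0.
elim: n f => [|n IHn] f; rewrite polylog2_pb_cons.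
  have -> : bar_pb c d w34 (polylog2_pb (m :: u) v) f = 0.
    by rewrite /bar_pb !IH !mulr0 addr0.
  by case: m {IH} => [|m] /=; rewrite ?(bar_pb_const r12) ?(bar_pb_const r23)
    ?(bar_pb_const rB) ?oppr0 ?addr0.
have -> : bar_pb c d w45 (polylog2_pb (m :: u) (n :: v)) f = 0.
  by rewrite /bar_pb !IHn !mulr0 addr0.
by case: m {IH IHn} => [|m] /=; rewrite ?(bar_pb_const r12) ?(bar_pb_const r23)
    ?(bar_pb_const rB) ?oppr0 ?addr0.
Qed.

(** The steps that decrease an entry vanish and the other ones remove an entry
    equal to 1 or move an entry, so that an entry greater than 1 is never lost;
    it makes the functional vanish in the end. *)
Lemma polylog2_pb_432 u v f : restr w12 = (0, 0) -> restr w45 = (0, 0) ->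
  restr w24 = (0, 0) -> ~~ (all0 u && all0 v) -> polylog2_pb u v f = 0.
Proof.
move=> r12 r45 r24; move: u v f; apply: weight_ind2 => u v IH f.
have rD := restrD r12 r45; rewrite addr0 in rD.
case: u v IH => [|m u] [|n v] // IH uv.
- by rewrite polylog2_pb_nill polylog1_pb_all0.
- by rewrite polylog2_pb_nilr polylog1_pb_all0 //; move: uv; rewrite andbT.
have pf0 w u' v' : (weight u' + weight v' < weight (m :: u) + weight (n :: v))%N ->
    ~~ (all0 u' && all0 v') -> bar_pb c d w (polylog2_pb u' v') f = 0.
  by move=> lt nn; rewrite /bar_pb !IH // !mulr0 addr0.
have wb := weight_belast n v; rewrite polylog2_pb_cons.
have ab : all0 (last n v :: u) && all0 (belast n v) = all0 u && all0 (n :: v).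
  by rewrite (lastI n v) all_rcons /=; case: (_ == _); rewrite ?andbF.
rewrite [X in X + _](_ : _ = 0) ?add0r.
  case: n {wb ab IH} pf0 uv => [|n] /= pf0 uv; rewrite ?(bar_pb_const r45) //.
  by rewrite pf0 ?oppr0 // !weight_cons; lia.
case: m pf0 uv {IH} => [|m] /= pf0 uv; rewrite ?(bar_pb_const r12) //.
by rewrite !pf0 ?oppr0 ?addr0 ?ab //; move: wb; rewrite !weight_cons; lia.
Qed.

(** The two functionals that the first index contributes with the restrictions of
    [w23] and [w12 - w23] both amount to the coefficient of the same word, and
    cancel; the second index is thus read first. *)
Lemma polylog2_pb_215 u v f : restr w12 = (0, 0) -> restr w45 = (1, 0) ->
    restr w23 = (0, 1) -> restr w34 = (0, 1) -> restr w24 = (0, 1) ->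
  polylog2_pb u v f = pi_Y f (v ++ u).
Proof.
move=> r12 r45 r23 r34 r24; move: u v f; apply: weight_ind2 => u v IH f.
have rD := restrD r12 r45; rewrite !add0r in rD.
have rB := restrB r12 r23; rewrite subr0 sub0r in rB.
case: u v IH => [|m u] [|n v] IH.
- by rewrite polylog2_pb_nill polylog1_pb_pi_Y.
- by rewrite polylog2_pb_nill polylog1_pb_pi_Y // cats0.
- by rewrite polylog2_pb_nilr polylog1_pb_pi_Y.
have wb := weight_belast n v; rewrite polylog2_pb_cons.
rewrite [X in X + _](_ : _ = 0) ?add0r.
  case: n {wb} IH => [|n] /= IH.
    rewrite (bar_pb_x1 r34) IH ?pi_Y_0 // !weight_cons; lia.
  by rewrite (bar_pb_x0 r45) IH ?pi_Y_S // !weight_cons; lia.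
case: m IH => [|m] /= IH; rewrite ?(bar_pb_const r12) //.
rewrite (bar_pb_x1 r23) IH; last by rewrite !weight_cons; lia.
rewrite /bar_pb !IH; try by move: wb; rewrite !weight_cons; lia.
case: rB => -> ->; rewrite mul0r add0r mulN1r opprK.
by rewrite -cat_rcons -lastI addNr.
Qed.

Section Term451.
Hypotheses (r12 : restr w12 = (1, 0)) (r45 : restr w45 = (0, 0)).
Hypotheses (r23 : restr w23 = (0, 1)) (r34 : restr w34 = (0, 1)) (r24 : restr w24 = (0, 1)).

Lemma polylog2_pb_451_nilr u f : polylog2_pb u [::] f = pi_Y f u.
Proof.
by rewrite polylog2_pb_nilr polylog1_pb_pi_Y //; have := restrD r12 r45; rewrite !addr0.
Qed.

Lemma polylog2_pb_451_nill n v f : polylog2_pb [::] (n :: v) f =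
  if n is 0 then - polylog2_pb [::] v (lquo x1 f) else 0.
Proof.
rewrite !polylog2_pb_nill polylog1_pb_cons; case: n => [|n].
  by rewrite (bar_pb_x1 r34).
by rewrite (bar_pb_const r45).
Qed.

Lemma polylog2_pb_451_cons m u n v f : polylog2_pb (m :: u) (n :: v) f =
  (if m is m'.+1 then polylog2_pb (m' :: u) (n :: v) (lquo x0 f) else
     - polylog2_pb u (n :: v) (lquo x1 f)
     - (polylog2_pb (last n v :: u) (belast n v) (lquo x0 f)
        - polylog2_pb (last n v :: u) (belast n v) (lquo x1 f)))
  + (if n is 0 then - polylog2_pb (m :: u) v (lquo x1 f) else 0).
Proof.
have rB := restrB r12 r23; rewrite subr0 sub0r in rB.
rewrite polylog2_pb_cons; congr (_ + _).
  case: m => [|m]; last by rewrite (bar_pb_x0 r12).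
  rewrite (bar_pb_x1 r23) /bar_pb; case: rB => -> ->.
  by rewrite mul1r mulN1r.
by case: n => [|n]; rewrite ?(bar_pb_x1 r34) ?(bar_pb_const r45).
Qed.

End Term451.

End Evaluation.

(** * Equivalence of the two families of relations *)

Section Triangularity.
Variable k : comNzRingType.
Implicit Types (H : seq nat -> seq nat -> k) (a b c d e : seq nat).

(** The last term of the sum, where [a] is used up by the cut, is the only one
    whose second argument has full length. *)
Lemma sum_split_last H d a b : b != [::] -> ~~ (all0 (d ++ a) && all0 b) ->
    (forall c e, c != [::] -> ~~ (all0 e && all0 c) ->
       (size e < size (d ++ a))%N -> H c e = 0) ->
  sum_split H d a b = H b (d ++ a).
Proof.
move=> b0; elim: a d => [|m a IH] d dab H0; first by rewrite sum_split_nil cats0.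
rewrite sum_split_cons IH ?cat_rcons // big_seq big1 ?add0r // => c.
move=> /mem_qshuffle_headr cab; apply: H0; last by rewrite size_cat /= addnS ltnS leq_addr.
  by apply: contraNneq b0 => c0; move/qshuffle_weight: cab; rewrite c0; case: (b).
apply: contra dab => /andP[d0 /(qshuffle_all0 cab) /andP[ma0 ->]].
by rewrite all_cat d0 ma0.
Qed.

End Triangularity.

Section DoubleShuffleRelations.
Variable k : fieldType.
Hypothesis char_k : [pchar k] =i pred0.
Implicit Types (psi f : series k bool) (u v w a b c d e : seq nat).

Lemma sum_shuffle_nseq (x : bool) n f :
  \sum_(w <- shuffle [:: x] (nseq n x)) f w = n.+1%:R * f (nseq n.+1 x).
Proof.
elim: n f => [|n IH] f; first by rewrite shuffle_nilr big_seq1 mul1r.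
rewrite sum_shuffle_cons big_seq1 (IH (lquo x f)) /lquo -[n.+2]add1n natrD.
by rewrite mulrDl mul1r.
Qed.

Lemma primitive_nseq f x n : primitive f -> f (nseq n.+2 x) = 0.
Proof.
move=> /(_ x [::] x (nseq n x)).
rewrite (sum_shuffle_nseq x n.+1) => /eqP; rewrite mulf_eq0.
by have /pcharf0P -> := char_k => /eqP.
Qed.

Lemma psi_starE psi w : psi_star psi w = psi_corr psi w + pi_Y psi w.
Proof. by []. Qed.

Lemma pi_YE f w : pi_Y f w = (-1) ^+ size w * f (word_of w).
Proof. by []. Qed.

Lemma psi_star_not_all0 psi w : ~~ all0 w -> psi_star psi w = pi_Y psi w.
Proof.
move=> w0; rewrite psi_starE /psi_corr.
have /negPf-> : w != nseq (size w) 0%N by apply: contra w0 => /eqP/all_pred1P.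
by rewrite andbF add0r.
Qed.

Lemma word_of_nseq n : word_of (nseq n 0%N) = nseq n x1.
Proof. by elim: n => //= n IH; rewrite word_of_0 IH. Qed.

(** This is the relation between y_1 and y_1^(n+1), once it is reduced by the
    other ones, see [all_qshuffle_relations]. It determines the coefficients of
    psi_corr, given that those of pi_Y(psi) at powers of y_1 vanish. *)
Lemma psi_star_zeros psi n : primitive psi ->
  n.+2%:R * psi_star psi (nseq n.+2 0%N) + (-1) ^+ n * psi_star psi [:: n.+1] = 0.
Proof.
move=> F; rewrite [psi_star _ [:: _]]psi_star_not_all0 //.
rewrite psi_starE !pi_YE word_of_nseq primitive_nseq // mulr0 addr0.
rewrite /psi_corr size_nseq eqxx [word_of _]cats0 /=.
have n2 : n.+2%:R != 0 :> k by have /pcharf0P -> := char_k.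
by rewrite !exprS expr0; move: n.+2%:R n2 => N n2; field.
Qed.

Lemma eq_sum_not_all0 psi u v : ~~ (all0 u && all0 v) ->
  \sum_(w <- qshuffle u v) psi_star psi w = \sum_(w <- qshuffle u v) pi_Y psi w.
Proof.
move=> uv; rewrite big_seq [RHS]big_seq; apply: eq_bigr => w wuv.
by apply: psi_star_not_all0; apply: contra uv; exact: qshuffle_all0.
Qed.

Lemma dmr0_relations psi : lie_series psi ->
    psi [:: x0] = 0 -> psi [:: x1] = 0 -> psi [:: x0; x1] = 0 ->
  dmr0 psi <-> forall u v, u != [::] -> v != [::] -> ~~ (all0 u && all0 v) ->
    \sum_(w <- qshuffle u v) pi_Y psi w = 0.
Proof.
move=> L p0 p1 p01; have [pnil F] := lie_series_primitive L.
have S0 : psi_star psi [::] = 0.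
  by rewrite psi_starE pi_Y_nil pnil addr0.
have [toH ofH] := Delta_star_primitive S0.
split=> [[_ _ _ _ /toH H] u v u0 v0 uv|H].
  rewrite -eq_sum_not_all0 //; by case: u v u0 v0 {uv} => [|p u] [|q v].
split=> //; apply: ofH => p u q v.
apply: all_qshuffle_relations => // [n|u' v' u0 v0 uv]; first exact: psi_star_zeros.
by rewrite eq_sum_not_all0 // H.
Qed.

End DoubleShuffleRelations.

Section Relations.
Variable k : fieldType.
Implicit Types (psi f : series k bool) (u v w a b c d e : seq nat).

(** [G c d psi - pi_Y psi (d ++ c)] vanishes for [d] empty, and its
    [sum_split] is minus a quasi-shuffle sum. By [sum_split_last] it is determined
    by these sums, by induction on the length of [d]. *)
Lemma defect_relations (G : seq nat -> seq nat -> series k bool -> k) psi :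
    (forall u f, G u [::] f = pi_Y f u) ->
    (forall m a n b, split_G G [::] (m :: a) (n :: b) psi = 0) ->
  (forall u v, u != [::] -> v != [::] -> ~~ (all0 u && all0 v) ->
     \sum_(w <- qshuffle u v) pi_Y psi w = 0) <->
  (forall c d, c != [::] -> d != [::] -> ~~ (all0 c && all0 d) ->
     G c d psi = pi_Y psi (d ++ c)).
Proof.
move=> G_nilr T0; pose H c d := G c d psi - pi_Y psi (d ++ c).
have H0 c : H c [::] = 0 by rewrite /H G_nilr subrr.
have split_H a b : a != [::] -> b != [::] ->
    sum_split H [::] a b = - \sum_(w <- qshuffle a b) pi_Y psi w.
  case: a b => [|m a] [|n b] // _ _.
  rewrite -(sum_split_cat (pi_Y psi) [::]); apply/eqP; rewrite -addr_eq0 -sum_splitD.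
  apply/eqP; rewrite -(T0 m a n b) /split_G /H.
  congr (sum_split _ _ _ _); apply/funext => c; apply/funext => d.
  by rewrite subrK.
split=> E.
  move=> c d; have [s] := ubnP (size d); elim: s c d => // s IH c d ds c0 d0 cd.
  have lt0 c' e : c' != [::] -> ~~ (all0 e && all0 c') ->
      (size e < size d)%N -> H c' e = 0.
    case: e => [|n e] c'0 ec le; first exact: H0.
    by rewrite /H IH ?subrr // 1?andbC //; exact: leq_trans le _.
  apply/eqP; rewrite -subr_eq0 -/(H c d).
  by rewrite -(@sum_split_last _ H [::] d c) // 1?andbC // split_H // E ?oppr0 // andbC.
move=> a b a0 b0 ab; apply/eqP; rewrite -oppr_eq0 -split_H //.
have H1 c e : c != [::] -> ~~ (all0 e && all0 c) -> H c e = 0.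
  by case: e => [|n e] c0 ec; rewrite ?H0 // /H E ?subrr // andbC.
by rewrite sum_split_last ?cat0s ?H1 // => c e c0 ec _; exact: H1.
Qed.

(** The value on the class of a series may be computed on the series, since l^{y,x}
    is integrable. *)
Lemma on_Up5_defect psi a b : positive a -> positive b ->
  on_Up5 (@l_yx k a b) (pentagon_defect psi) =
    @l_yx k a b (pullback (4, 5) (5, 1) psi)
  + @l_yx k a b (pullback (1, 2) (2, 3) psi)
  - @l_yx k a b (pullback (4, 3) (3, 2) psi)
  - @l_yx k a b (pullback (2, 1) (1, 5) psi)
  - @l_yx k a b (pullback (5, 4) (4, 3) psi).
Proof.
move=> Ha Hb; rewrite /pentagon_defect /psi5 -!(raddfB, raddfD) /= l_yx_descends //.
have lin : linear_fun (@l_yx k a b) by exact: lin_polylog2.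
by rewrite !(linB _ _ lin, linD _ _ lin).
Qed.

End Relations.

Section Defect.
Variable k : fieldType.
Implicit Types (psi f : series k bool) (u v w a b c d e : seq nat).

Lemma restr_intr (o : gen5 -> int) (c d : gen5) (x y : int) :
  (o c, o d) = (x, y) -> ((o c)%:~R : k, (o d)%:~R : k) = (x%:~R, y%:~R).
Proof. by case=> -> ->. Qed.

Definition defect_451 := polylog2_pb (4, 5) (5, 1)
  (omega45 k) (omega12 k) (omega34 k) (omega23 k) (omega24 k).

(* The restrictions to two letters are decided by computing with integers, before
   their image in [k] is taken. *)
Let const_omega (o : gen5 -> int) (c d : gen5) : (o c, o d) = (0, 0) ->
  ((o c)%:~R : k, (o d)%:~R : k) = (0, 0) := @restr_intr o c d 0 0.
Let x0_omega (o : gen5 -> int) (c d : gen5) : (o c, o d) = (1, 0) ->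
  ((o c)%:~R : k, (o d)%:~R : k) = (1, 0) := @restr_intr o c d 1 0.
Let x1_omega (o : gen5 -> int) (c d : gen5) : (o c, o d) = (0, 1) ->
  ((o c)%:~R : k, (o d)%:~R : k) = (0, 1) := @restr_intr o c d 0 1.

Lemma l_yx_defect psi u v : u != [::] -> v != [::] -> ~~ (all0 u && all0 v) ->
  on_Up5 (@l_yx k (index_of u) (index_of v)) (pentagon_defect psi) =
    defect_451 u v psi - pi_Y psi (v ++ u).
Proof.
move=> u0 v0 uv; rewrite on_Up5_defect ?positive_index_of //.
have -> : @l_yx k (index_of u) (index_of v) (pullback (1, 2) (2, 3) psi) = 0.
  by apply: polylog2_pb_123 => //; apply: const_omega; vm_compute.
have -> : @l_yx k (index_of u) (index_of v) (pullback (4, 3) (3, 2) psi) = 0.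
  by apply: polylog2_pb_432 => //; apply: const_omega; vm_compute.
have -> : @l_yx k (index_of u) (index_of v) (pullback (5, 4) (4, 3) psi) = 0.
  apply: polylog2_pb_543; rewrite /nilp ?size_cat ?addn_eq0 ?size_eq0 ?negb_and ?u0 //;
    by apply: const_omega; vm_compute.
have -> : @l_yx k (index_of u) (index_of v) (pullback (2, 1) (1, 5) psi) =
    pi_Y psi (v ++ u).
  by apply: polylog2_pb_215; [apply: const_omega | apply: x0_omega | apply: x1_omega
    | apply: x1_omega | apply: x1_omega]; vm_compute.
by rewrite addr0 !subr0.
Qed.

Let r12 : (omega45 k (4, 5), omega45 k (5, 1)) = (1, 0).
Proof. by apply: x0_omega; vm_compute. Qed.
Let r45 : (omega12 k (4, 5), omega12 k (5, 1)) = (0, 0).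
Proof. by apply: const_omega; vm_compute. Qed.
Let r23 : (omega34 k (4, 5), omega34 k (5, 1)) = (0, 1).
Proof. by apply: x1_omega; vm_compute. Qed.
Let r34 : (omega23 k (4, 5), omega23 k (5, 1)) = (0, 1).
Proof. by apply: x1_omega; vm_compute. Qed.
Let r24 : (omega24 k (4, 5), omega24 k (5, 1)) = (0, 1).
Proof. by apply: x1_omega; vm_compute. Qed.

Lemma defect_451_nilr u f : defect_451 u [::] f = pi_Y f u.
Proof. by apply: polylog2_pb_451_nilr; [exact: r12 | exact: r45 | exact: r24]. Qed.

Lemma defect_451_primitive psi m u n v : psi [::] = 0 -> primitive psi ->
  split_G defect_451 [::] (m :: u) (n :: v) psi = 0.
Proof.
apply: split_G_primitive.
- exact: defect_451_nilr.
- by apply: polylog2_pb_451_nill; [exact: r45 | exact: r34].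
- by apply: polylog2_pb_451_cons; [exact: r12 | exact: r45 | exact: r23 | exact: r34].
Qed.

End Defect.

Lemma index_of_pred a : positive a -> index_of (rev (map predn a)) = a.
Proof.
move=> pa; rewrite /index_of map_rev revK -map_comp map_id_in // => n /(allP pa).
exact: prednK.
Qed.

Lemma all1_index_of u : all (pred1 1%N) (index_of u) = all0 u.
Proof. by rewrite /index_of all_rev all_map. Qed.

Theorem theoremA (k : fieldType) (char_k : [pchar k] =i pred0)
    (psi : series k bool) (psi_lie : lie_series psi)
    (psi_x0 : psi [:: x0] = 0) (psi_x1 : psi [:: x1] = 0)
    (psi_x0x1 : psi [:: x0; x1] = 0) :
  dmr0 psi <->
  (forall a b : seq nat, is_index a -> is_index b ->
     ~~ (all (pred1 1%N) a && all (pred1 1%N) b) ->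
     on_Up5 (l_yx a b) (pentagon_defect psi) = 0).
Proof.
have [psi0 prim] := lie_series_primitive psi_lie.
have [toG ofG] := defect_relations (@defect_451_nilr k)
  (fun m a n b => defect_451_primitive m a n b psi0 prim).
have [toR ofR] := dmr0_relations char_k psi_lie psi_x0 psi_x1 psi_x0x1.
split=> [/toR/toG E a b /andP[a0 pa] /andP[b0 pb] ab | E].
  move: a0 b0 ab; rewrite -(index_of_pred pa) -(index_of_pred pb) !all1_index_of.
  set u := rev _; set v := rev _; rewrite -!size_eq0 !size_rev !size_map => a0 b0 ab.
  have u0 : u != [::] by rewrite -size_eq0.
  have v0 : v != [::] by rewrite -size_eq0.
  by rewrite l_yx_defect // E // subrr.
apply/ofR/ofG => u v u0 v0 uv; apply/eqP.
have index_u w : w != [::] -> is_index (index_of w).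
  by move=> w0; rewrite /is_index positive_index_of -size_eq0 size_rev size_map size_eq0 w0.
by rewrite -subr_eq0 -l_yx_defect // E ?index_u // !all1_index_of.
Qed.
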